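(* Let $\tau<\lambda$ be infinite cardinals with $\tau$ regular and $\lambda$ a singular strong limit cardinal. Then the following are equivalent: (a) $S^{\lambda^+}_\tau\in I[\lambda^+]$; (b) $Pr(\lambda,\tau)$; (c) $Pr'(\lambda,\tau)$; (d) $\mathrm{CECA}_\tau(\lambda^+)$. Moreover, if $\tau=\sigma^+$, then each of (a), (b), (c), (d) is also equivalent to (e) $Sp(\sigma,\lambda)$.
   Context: $[X]^{\tau}$ (resp. $[X]^{<\tau}$) is the set of subsets of $X$ of cardinality $\tau$ (resp. $<\tau$). $H(\Theta)$ is the set of all sets hereditarily of cardinality $<\Theta$. $S^{\lambda^+}_\tau=\{\alpha<\lambda^+: cf(\alpha)=\tau\}$. Let $\tau$ be a regular cardinal. A set $M$ is weakly $\tau$-closed if for every $I\in[M]^\tau$ there is $J\in[I]^\tau$ with $[J]^{<\tau}\subset M$. $M$ is weakly $\tau$-closed with respect to sets of ordinals if for every set of ordinals $I\in[M]^\tau$ there is $J\in[I]^\tau$ with $[J]^{<\tau}\subset M$. $I[\kappa]$ (for $\kappa$ regular uncountable) is the family of all $A\subseteq\kappa$ such that $\{\delta\in A:\delta=cf(\delta)\}$ is not stationary in $\kappa$ and for some sequence $\langle\mathcal P_\alpha:\alpha<\kappa\rangle$: (i) each $\mathcal P_\alpha$ is a family of fewer than $\kappa$ subsets of $\alpha$; (ii) for every limit $\alpha\in A$ with $cf(\alpha)<\alpha$ there is $x\subset\alpha$ such that $otp(x)<\alpha=\sup x$ and for all $\beta<\alpha$, $x\cap\beta\in\bigcup_{\gamma<\alpha}\mathcal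 P_\gamma$. $Pr(\lambda,\tau)$: there is an increasing continuous chain $\langle N_i:i<\lambda^+\rangle$ such that $|N_i|=\lambda$ and $N_i$ is weakly $\tau$-closed for each $i<\lambda^+$, and $\lambda^+\subset\bigcup_{i<\lambda^+}N_i$. $Pr'(\lambda,\tau)$: there is an increasing continuous chain $\langle N_i:i<\lambda^+\rangle$ such that $|N_i|=\lambda$ and $N_i$ is weakly $\tau$-closed with respect to sets of ordinals for each $i<\lambda^+$, and $\lambda^+\subset\bigcup_{i<\lambda^+}N_i$. An $\in$-chain is a sequence $\langle M_\xi:\xi<\alpha\rangle$ such that $M_\xi\subset M_\eta$ and $\langle M_\xi:\xi\le\eta\rangle\in M_{\eta+1}$ for all $\xi<\eta<\alpha$; it is continuous if unions are taken at limit indices. $\mathrm{CECA}_\tau(\kappa)$, for a cardinal $\kappa$: for every cardinal $\Theta>\kappa$, and for every pair of sets $A,B$ with $|A|=\kappa$, $|B|<\kappa$, there exists a continuous $\in$-chain $\langle M_\xi\rangle_{\xi<cf(\kappa)}$ of weakly $\tau$-closed elementary submodels of $H(\Theta)$ such that $|M_\xi|<\kappa$ for every $\xi<cf(\kappa)$, $B\in M_0$, and $A\subset\bigcup_{\xi<cf(\kappa)}M_\xi$. $Sp(\sigma,\lambda)$: there is a sequence $\langle\mathcal P_\xi:\xi<\lambda^+\rangle$ such that for all $\xi<\lambda^+$, $\mathcal P_\xi\subset[\xi]^\sigma$ and $|\mathcal P_\xi|\le\lambda$; moreover if $\xi<\lambda^+$ with $cf(\xi)=\sigma^+$ and $x$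 is a cofinal subset of $\xi$ of cardinality $\sigma^+$, then $x$ can be written as $x=\bigcup\{x_\nu:\nu\in\sigma\}$ where $[x_\nu]^\sigma\subset\bigcup_{\eta<\xi}\mathcal P_\eta$ for each $\nu\in\sigma$.
   Formalization: In CECA_τ(κ) the sets A and B are required to belong to H(Θ); for arbitrary sets A, B the condition could never hold, since it demands B∈M_0⊂H(Θ) and A⊂⋃M_ξ⊂H(Θ). *)

(* Defs.v *)
From HB Require Import structures.
From mathcomp Require Import all_boot generic_quotient.
From mathcomp Require Import boolp classical_sets functions cardinality.
Set Implicit Arguments.
Unset Strict Implicit.
Unset Printing Implicit Defensive.
Local Open Scope quotient_scope.
Local Open Scope classical_set_scope.
Local Open Scope card_scope.

(** * The universe of sets

    Well-founded trees modulo bisimulation (Aczel's interpretation).  With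
    classical logic and choice this is a model of ZFC, in which the cumulative
    hierarchy, [H(Theta)] and von Neumann ordinals are available. *)

Inductive tree : Type := node (A : Type) (f : A -> tree).

Fixpoint bisim (s t : tree) : Prop :=
  match s, t with
  | node A f, node B g =>
      (forall a, exists b, bisim (f a) (g b)) /\
      (forall b, exists a, bisim (f a) (g b))
  end.

Lemma bisim_refl s : bisim s s.
Proof. by elim: s => A f IH /=; split=> a; exists a. Qed.

Lemma bisim_sym s t : bisim s t -> bisim t s.
Proof.
elim: s t => A f IH [B g] /= [H1 H2]; split.
- by move=> b; have [a Hab] := H2 b; exists a; apply: IH.
- by move=> a; have [b Hab] := H1 a; exists b; apply: IH.
Qed.

Lemma bisim_trans s t u : bisim s t -> bisim t u -> bisim s u.
Proof.
elim: s t u => A f IH [B g] [C h] /= [H1 H2] [H3 H4]; split.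
- move=> a; have [b Hab] := H1 a; have [c Hbc] := H3 b.
  by exists c; apply: IH Hab Hbc.
- move=> c; have [b Hbc] := H4 c; have [a Hab] := H2 b.
  by exists a; apply: IH Hab Hbc.
Qed.

HB.instance Definition _ := gen_eqMixin tree.
HB.instance Definition _ := gen_choiceMixin tree.

Definition bisimb (s t : tree) : bool := `[< bisim s t >].

Lemma bisimb_refl : reflexive bisimb.
Proof. by move=> s; apply/asboolP/bisim_refl. Qed.

Lemma bisimb_sym : symmetric bisimb.
Proof. by move=> s t; apply/asboolP/asboolP; apply: bisim_sym. Qed.

Lemma bisimb_trans : transitive bisimb.
Proof.
by move=> t s u /asboolP st /asboolP tu; apply/asboolP/(bisim_trans st tu).
Qed.

Canonical bisimb_equiv := EquivRel bisimb bisimb_refl bisimb_sym bisimb_trans.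

Definition V : Type := {eq_quot bisimb}.
HB.instance Definition _ := Choice.on V.
HB.instance Definition _ := EqQuotient.on V.
HB.instance Definition _ :=
  isPointed.Build V (\pi_V (@node False (False_rect tree))).

Definition vmem (x y : V) : Prop :=
  let: node A f := repr y in exists a : A, x = \pi_V (f a).

Declare Scope V_scope.
Delimit Scope V_scope with V.
Local Open Scope V_scope.

Notation "x ∈ y" := (vmem x y) (at level 70, no associativity) : V_scope.

Definition vsub (x y : V) : Prop := forall z, z ∈ x -> z ∈ y.
Notation "x ⊆ y" := (vsub x y) (at level 70, no associativity) : V_scope.

Definition elts (x : V) : set V := [set y | y ∈ x].

(** [vset P] is the set [{x | P x}] as an element of [V]; it is only meaningful
    when the class [P] is a set (see [in_vset] below). *)
Definition vset (P : V -> Prop) : V := get [set s : V | forall x, x ∈ s <-> P x].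

(** ** Extensionality, epsilon-induction, comprehension for small classes

    [in_vset] with the index types [False], [bool], [nat], the branching type
    of a tree, a sigma type, or [A -> Prop], yields the empty set, pairing,
    infinity, separation and replacement, union, and power set. *)

Lemma pi_eqP (s t : tree) : \pi_V s = \pi_V t <-> bisim s t.
Proof. by split=> [/eqmodP/asboolP//|st]; apply/eqmodP/asboolP. Qed.

Lemma vmem_pi x (A : Type) (f : A -> tree) :
  x ∈ \pi_V (node f) <-> exists a, x = \pi_V (f a).
Proof.
rewrite /vmem; case E: (repr _) => [B g].
have : bisim (node g) (node f) by rewrite -E; apply/pi_eqP; rewrite reprK.
move=> /= [H1 H2]; split=> -[a ->].
- by have [b /pi_eqP ->] := H1 a; exists b.
- by have [b /pi_eqP <-] := H2 a; exists b.
Qed.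

Lemma vP x : exists (A : Type) (f : A -> tree), x = \pi_V (node f).
Proof. by rewrite -[x]reprK; case: (repr x) => A f; exists A, f. Qed.

Lemma vext (x y : V) : (forall z, z ∈ x <-> z ∈ y) -> x = y.
Proof.
have [A [f ->]] := vP x; have [B [g ->]] := vP y => H.
apply/pi_eqP; split.
- move=> a; have /H/vmem_pi[b /pi_eqP ?] : \pi_V (f a) ∈ \pi_V (node f).
    by apply/vmem_pi; exists a.
  by exists b.
- move=> b; have /H/vmem_pi[a /pi_eqP/bisim_sym ?] :
    \pi_V (g b) ∈ \pi_V (node g) by apply/vmem_pi; exists b.
  by exists a.
Qed.

Lemma vmem_ind (P : V -> Prop) :
  (forall x, (forall y, y ∈ x -> P y) -> P x) -> forall x, P x.
Proof.
move=> H x; rewrite -[x]reprK; elim: (repr x) => A f IH.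
by apply: H => y /vmem_pi[a ->].
Qed.

Lemma in_vset (A : Type) (f : A -> V) (P : V -> Prop) :
  (forall x, P x -> exists a, x = f a) -> forall x, x ∈ vset P <-> P x.
Proof.
move=> Pf; rewrite /vset.
apply: (@getPex _ [set s : V | forall x, x ∈ s <-> P x]).
exists (\pi_V (@node {a : A | P (f a)} (fun a => repr (f (sval a))))) => x.
split=> [/vmem_pi[[a Pa] ->] /=|Px]; first by rewrite reprK.
apply/vmem_pi; have [a xa] := Pf x Px; move: Px; rewrite xa => Pa.
by exists (exist _ a Pa); rewrite reprK.
Qed.

(** * Basic set operations *)

Definition vempty : V := vset (fun _ => False).
Definition vpair (x y : V) : V := vset (fun z => z = x \/ z = y).
Definition vopair (x y : V) : V := vpair (vpair x x) (vpair x y).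
Definition vcap (x y : V) : V := vset (fun z => z ∈ x /\ z ∈ y).
Definition vunion (x : V) : V := vset (fun z => exists2 y, y ∈ x & z ∈ y).
Definition vbigcup (x : V) (F : V -> V) : V :=
  vset (fun z => exists2 i, i ∈ x & z ∈ F i).
Definition vpow (x : V) : V := vset (fun z => z ⊆ x).
Definition vsucc (x : V) : V := vset (fun z => z ∈ x \/ z = x).

Definition is_trans (x : V) : Prop := forall y, y ∈ x -> y ⊆ x.
Definition trcl (x : V) : V :=
  vset (fun y => forall t, is_trans t -> x ⊆ t -> y ∈ t).

(** A sequence [<M_i : i < alpha>] is represented by [M : V -> V], of which
    only the values on [alpha] matter; by replacement every such restriction is
    a set, namely [vgraph alpha M]. *)
Definition vgraph (a : V) (M : V -> V) : V :=
  vset (fun p => exists2 i, i ∈ a & p = vopair i (M i)).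

(** * Ordinals and cardinals (von Neumann; [α < β] is [α ∈ β]) *)

Definition is_ord (a : V) : Prop :=
  is_trans a /\ forall b, b ∈ a -> is_trans b.

Definition is_limit (a : V) : Prop :=
  [/\ is_ord a, a <> vempty & forall b, b ∈ a -> vsucc b ∈ a].

Definition least (P : V -> Prop) : V :=
  get [set a | [/\ is_ord a, P a & forall b, is_ord b -> P b -> a ⊆ b]].

Definition is_card (k : V) : Prop :=
  is_ord k /\ forall a, a ∈ k -> ~ (elts a #= elts k).

Definition is_inf_card (k : V) : Prop := is_card k /\ infinite_set (elts k).

Definition vcard (x : V) : V := least (fun a => elts x #= elts a).

Definition card_succ (k : V) : V := least (fun m => is_card m /\ k ∈ m).
Notation "k ⁺" := (card_succ k) (at level 2, format "k ⁺") : V_scope.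

Definition is_cofinal (c a : V) : Prop :=
  c ⊆ a /\ forall b, b ∈ a -> exists2 d, d ∈ c & b ⊆ d.

Definition cf (a : V) : V :=
  least (fun b => exists2 c, is_cofinal c a & elts c #= elts b).

Definition is_regular (k : V) : Prop := is_inf_card k /\ cf k = k.
Definition is_singular (k : V) : Prop := is_inf_card k /\ cf k <> k.
Definition is_strong_limit (k : V) : Prop :=
  is_inf_card k /\ forall m, m ∈ k -> vcard (vpow m) ∈ k.

Definition ords (x : V) : Prop := forall a, a ∈ x -> is_ord a.

Definition otp (x : V) : V :=
  get [set a | is_ord a /\
    exists f : V -> V, set_bij (elts x) (elts a) f /\
      forall b c, b ∈ x -> c ∈ x -> b ∈ c -> f b ∈ f c].

(** [[X]^τ] and [[X]^{<τ}] *)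
Definition subs (X t : V) : V := vset (fun y => y ⊆ X /\ vcard y = t).
Definition subs_lt (X t : V) : V := vset (fun y => y ⊆ X /\ vcard y ∈ t).

(** A set is hereditarily of cardinality [< Θ] when it and all the members of
    its transitive closure have cardinality [< Θ].  For regular [Θ] this amounts
    to the transitive closure having cardinality [< Θ]. *)
Definition Hset (T : V) : V :=
  vset (fun x => vcard x ∈ T /\ forall y, y ∈ trcl x -> vcard y ∈ T).

(** * Elementary submodels *)

Inductive formula :=
| FMem of nat & nat
| FEq of nat & nat
| FNot of formula
| FAnd of formula & formula
| FEx of nat & formula.

Definition update (e : nat -> V) (n : nat) (x : V) : nat -> V :=
  fun m => if m == n then x else e m.

Fixpoint sat (M : V) (e : nat -> V) (p : formula) : Prop :=
  match p with
  | FMem i j => e i ∈ e j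
  | FEq i j => e i = e j
  | FNot q => ~ sat M e q
  | FAnd q r => sat M e q /\ sat M e r
  | FEx n q => exists2 x, x ∈ M & sat M (update e n x) q
  end.

Definition elem_submodel (M N : V) : Prop :=
  [/\ M <> vempty, M ⊆ N &
      forall (p : formula) (e : nat -> V), (forall n, e n ∈ M) ->
        sat M e p <-> sat N e p].

(** * Stationary sets and the ideal [I[κ]] *)

Definition is_club (C k : V) : Prop :=
  [/\ is_cofinal C k &
      forall d, d ∈ k -> is_limit d -> is_cofinal (vcap C d) d -> d ∈ C].

Definition is_stationary (S k : V) : Prop :=
  forall C, is_club C k -> exists2 a, a ∈ S & a ∈ C.

Definition Scof (k t : V) : V := vset (fun a => a ∈ k /\ cf a = t).

Definition approach_ideal (k : V) : V :=
  vset (fun A =>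
    [/\ A ⊆ k,
        ~ is_stationary (vset (fun d => d ∈ A /\ d = cf d)) k &
        exists P : V -> V,
          (forall a, a ∈ k ->
             vcard (P a) ∈ k /\ forall x, x ∈ P a -> x ⊆ a) /\
          (forall a, a ∈ A -> is_limit a -> cf a ∈ a ->
             exists x,
               [/\ x ⊆ a, otp x ∈ a, vunion x = a &
                   forall b, b ∈ a -> vcap x b ∈ vbigcup a P])]).

(** * Weakly closed sets and the principles *)

Definition weakly_closed (t M : V) : Prop :=
  forall I, I ∈ subs M t -> exists2 J, J ∈ subs I t & subs_lt J t ⊆ M.

Definition weakly_closed_ord (t M : V) : Prop :=
  forall I, I ∈ subs M t -> ords I ->
    exists2 J, J ∈ subs I t & subs_lt J t ⊆ M.

Definition increasing (a : V) (N : V -> V) : Prop :=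
  forall i j, i ∈ j -> j ∈ a -> N i ⊆ N j.

Definition continuous (a : V) (N : V -> V) : Prop :=
  forall d, d ∈ a -> is_limit d -> N d = vbigcup d N.

Definition Pr (l t : V) : Prop :=
  exists N : V -> V,
    [/\ increasing (l⁺) N, continuous (l⁺) N,
        forall i, i ∈ l⁺ -> vcard (N i) = l /\ weakly_closed t (N i) &
        l⁺ ⊆ vbigcup (l⁺) N].

Definition Pr' (l t : V) : Prop :=
  exists N : V -> V,
    [/\ increasing (l⁺) N, continuous (l⁺) N,
        forall i, i ∈ l⁺ -> vcard (N i) = l /\ weakly_closed_ord t (N i) &
        l⁺ ⊆ vbigcup (l⁺) N].

Definition in_chain (a : V) (M : V -> V) : Prop :=
  forall i j, i ∈ j -> j ∈ a ->
    M i ⊆ M j /\ (vsucc j ∈ a -> vgraph (vsucc j) M ∈ M (vsucc j)).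

(** The sets [A] and [B] have to lie in [H(Θ)] for the conclusion
    [B ∈ M_0 ⊆ H(Θ)], [A ⊆ ⋃ M_ξ ⊆ H(Θ)] to make sense. *)
Definition CECA (t k : V) : Prop :=
  forall T, is_card T -> k ∈ T ->
  forall A B, A ∈ Hset T -> B ∈ Hset T -> vcard A = k -> vcard B ∈ k ->
  exists M : V -> V,
    [/\ in_chain (cf k) M, continuous (cf k) M,
        forall i, i ∈ cf k ->
          [/\ elem_submodel (M i) (Hset T), weakly_closed t (M i) &
              vcard (M i) ∈ k],
        B ∈ M vempty &
        A ⊆ vbigcup (cf k) M].

Definition Sp (s l : V) : Prop :=
  exists P : V -> V,
    (forall x, x ∈ l⁺ ->
       P x ⊆ subs x s /\ vcard (P x) ⊆ l) /\
    (forall a, a ∈ l⁺ -> cf a = s⁺ ->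
       forall x, is_cofinal x a -> vcard x = s⁺ ->
       exists y : V -> V,
         x = vbigcup s y /\
         forall n, n ∈ s -> subs (y n) s ⊆ vbigcup a P).

(* Main.v *)
Require Import Defs.
From mathcomp Require Import all_boot generic_quotient.
From mathcomp Require Import boolp classical_sets functions cardinality.
Set Implicit Arguments.
Unset Strict Implicit.
Unset Printing Implicit Defensive.
Local Open Scope quotient_scope.
Local Open Scope classical_set_scope.
Local Open Scope card_scope.
Local Open Scope V_scope.

(** Everything is reduced to one combinatorial property, [approachable l t]:
    there are [l] many sets attached to each ordinal below [l⁺] such that every
    [d < l⁺] of cofinality [t] has a cofinal subset of order type at most [t] all
    of whose proper initial segments are attached to ordinals below [d].  It is
    [(a)] up to thinning out the witnesses along a cofinal subset of their order
    type, and it follows from [Pr'] and from [Sp] by trading a thin cofinal set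
    for a subset of size [t] with enumerated small subsets.

    In the other direction, write each set [Y] of size [l] as an increasing union
    of pieces [dec Y n], [n < l], of size [< l].  As [l] is a strong limit, all
    subsets of all the pieces can be added without exceeding size [l].  If
    [t <= cf l], every subset of [Y] of size [< t] lies in a piece.  Otherwise the
    index of a piece can be taken in a cofinal set of size [cf l < t], which
    colours a set of size [t] with fewer than [t] colours; a small monochromatic
    set lies in a piece.  At a stage [d] of cofinality [t] of a chain
    [<X_i : i < l⁺>], a small monochromatic set lies in [⋃_(i ∈ w) dec X_i n] for
    some initial segment [w] of a witness of approachability at [d], and [w] is
    already enumerated before [d].  Closing off under these subsets makes a chain
    of Skolem hulls weakly [t]-closed. *)

(** * Cardinal comparison through injections and surjections *)

Lemma card_leI (T U : Type) (A : set T) (B : set U) (f : T -> U) :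
  (forall x, A x -> B (f x)) ->
  (forall x y, A x -> A y -> f x = f y -> x = y) -> A #<= B.
Proof.
move=> fAB finj; have /card_le_eql <- : f @` A #= A.
  by apply: inj_card_eq => x y /set_mem Ax /set_mem Ay; apply: finj.
by apply: subset_card_le => _ [x Ax <-]; apply: fAB.
Qed.

Lemma card_leE (T : Type) (U : pointedType) (A : set T) (B : set U) : A #<= B ->
  exists f : T -> U, (forall x, A x -> B (f x)) /\
    (forall x y, A x -> A y -> f x = f y -> x = y).
Proof.
move=> /pcard_leP[f]; exists f; split; first by move=> x Ax; apply: funS.
by move=> x y Ax Ay; apply: inj; apply: mem_set.
Qed.

Lemma card_leS (T : pointedType) (U : Type) (A : set T) (B : set U) : A #<= B ->
  exists g : U -> T, forall x, A x -> exists2 y, B y & g y = x.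
Proof. by move=> /pcard_surjP[g gs]; exists g => x /gs[y By <-]; exists y. Qed.

Lemma card_eqE (T : Type) (U : pointedType) (A : set T) (B : set U) : A #= B ->
  exists f : T -> U, [/\ forall x, A x -> B (f x),
    forall x y, A x -> A y -> f x = f y -> x = y &
    forall y, B y -> exists2 x, A x & f x = y].
Proof.
move=> /pcard_eqP[f]; exists f; split; first by move=> x Ax; apply: funS.
- by move=> x y Ax Ay; apply: inj; apply: mem_set.
- by move=> y /(@surj _ _ _ _ f)[x Ax <-]; exists x.
Qed.

(** * Comprehension *)

(** Replacement: inverting an injection of the class into [x] indexes the class by the branches of a
    tree for [x], so [in_vset] applies. *)
Lemma in_vset_card (x : V) (P : V -> Prop) :
  [set z | P z] #<= elts x -> forall z, z ∈ vset P <-> P z.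
Proof.
have [A [f ->]] := vP x => /card_leE[h [hP hinj]].
apply: (@in_vset A (fun a => xget vempty [set s | P s /\ h s = \pi_V (f a)])).
move=> s Ps; have /vmem_pi[a ha] := hP s Ps; exists a.
case: xgetP => [s' _ [Ps' hs']|/(_ s)/(_ (conj Ps ha))//].
by apply: hinj => //; rewrite hs'.
Qed.

Lemma in_vsep (x : V) (P : V -> Prop) :
  (forall z, P z -> z ∈ x) -> forall z, z ∈ vset P <-> P z.
Proof. by move=> Px; apply: (@in_vset_card x); apply: subset_card_le. Qed.

Lemma in_vimage (x : V) (F : V -> V) z :
  z ∈ vset (fun z => exists2 i, i ∈ x & z = F i) <-> exists2 i, i ∈ x & z = F i.
Proof.
apply: (@in_vset_card x); apply: card_le_trans (card_image_le F (elts x)).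
by apply: subset_card_le => y [i xi ->]; exists i.
Qed.

Definition tbranch (t : tree) : Type := let: node A _ := t in A.

Lemma vbranchP (x : V) : exists h : tbranch (repr x) -> V,
  forall z, z ∈ x <-> exists b, z = h b.
Proof.
rewrite /vmem; case: (repr x) => A f; by exists (fun a => \pi_V (f a)).
Qed.

Lemma in_vset_Union (A : Type) (F : A -> V) z :
  z ∈ vset (fun z => exists a, z ∈ F a) <-> exists a, z ∈ F a.
Proof.
have [h hP] : exists h : forall a, tbranch (repr (F a)) -> V,
    forall a z, z ∈ F a <-> exists b, z = h a b.
  exists (fun a => sval (cid (vbranchP (F a)))) => a.
  by case: (cid (vbranchP (F a))).
apply: (@in_vset {a : A & tbranch (repr (F a))} (fun p => h (projT1 p) (projT2 p))).
by move=> x [a /hP[b ->]]; exists (existT _ a b).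
Qed.

Lemma in_vbigcup x F z : z ∈ vbigcup x F <-> exists2 i, i ∈ x & z ∈ F i.
Proof.
rewrite /vbigcup; have [h hP] := vbranchP x.
have E : (fun z => exists2 i, i ∈ x & z ∈ F i) = (fun z => exists a, z ∈ F (h a)).
  apply/funext => y; apply/propext; split.
    by move=> [i /hP[b ->] ?]; exists b.
  by move=> [a ?]; exists (h a) => //; apply/hP; exists a.
rewrite E in_vset_Union; split=> [[a ?]|[i /hP[a ->]]]; last by exists a.
by exists (h a) => //; apply/hP; exists a.
Qed.

Lemma in_vunion x z : z ∈ vunion x <-> exists2 y, y ∈ x & z ∈ y.
Proof. exact: in_vbigcup x id z. Qed.

Lemma in_vempty z : ~ z ∈ vempty.
Proof.
by move=> zE; have /(_ _)[|/(_ zE)] := @in_vset False (fun _ => point) (fun _ => False) _ z.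
Qed.

Lemma vempty_sub x : vempty ⊆ x.
Proof. by move=> z /in_vempty. Qed.

Lemma in_vpair x y z : z ∈ vpair x y <-> z = x \/ z = y.
Proof.
apply: (@in_vset bool (fun b => if b then x else y)).
by move=> w [->|->]; [exists true|exists false].
Qed.

Lemma in_vcap x y z : z ∈ vcap x y <-> z ∈ x /\ z ∈ y.
Proof. by apply: (@in_vsep x) => w []. Qed.

(** Subsets are indexed by predicates on the branches of [x]; predicates on [V] would not fit into
    the universe over which trees branch. *)
Lemma in_vpow x z : z ∈ vpow x <-> z ⊆ x.
Proof.
have [h hP] := vbranchP x.
apply: (@in_vset (tbranch (repr x) -> Prop)
  (fun p => vset (fun w => exists2 b, p b & w = h b))).
move=> y yx; exists (fun b => h b ∈ y); apply: vext => w.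
have E := @in_vsep x (fun w => exists2 b, h b ∈ y & w = h b).
rewrite E; last by move=> v [b _ ->]; apply/hP; exists b.
split=> [wy|[b ? ->//]]; have /hP[b bE] := yx _ wy.
by exists b => //; rewrite -bE.
Qed.

Lemma in_vsucc x z : z ∈ vsucc x <-> z ∈ x \/ z = x.
Proof.
have E : (fun z => z ∈ x \/ z = x) =
  (fun z => exists b : bool, z ∈ (if b then x else vpair x x)).
  apply/funext => y; apply/propext; split.
    by move=> [?|->]; [exists true|exists false; apply/in_vpair; left].
  by move=> [[]]; [left|move=> /in_vpair[]; right].
by rewrite /vsucc E in_vset_Union; have /= -> := congr1 (fun P : V -> Prop => P z) E.
Qed.

Lemma vsucc_refl x : x ∈ vsucc x. Proof. by apply/in_vsucc; right. Qed.

Lemma sub_vsucc x : x ⊆ vsucc x. Proof. by move=> z zx; apply/in_vsucc; left. Qed.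

Lemma vopair_inj x y x' y' : vopair x y = vopair x' y' -> x = x' /\ y = y'.
Proof.
have pp a b : vpair a a = vpair b b -> a = b.
  move=> E; have /in_vpair : a ∈ vpair b b by rewrite -E; apply/in_vpair; left.
  by case.
have pe a b c : vpair a b = vpair c c -> a = c /\ b = c.
  move=> E; split.
    have /in_vpair : a ∈ vpair c c by rewrite -E; apply/in_vpair; left.
    by case.
  have /in_vpair : b ∈ vpair c c by rewrite -E; apply/in_vpair; right.
  by case.
have pr a b c : vpair a b = vpair a c -> b = c.
  move=> E.
  have /in_vpair[bE|//] : b ∈ vpair a c by rewrite -E; apply/in_vpair; right.
  have /in_vpair[cE|//] : c ∈ vpair a b by rewrite E; apply/in_vpair; right.
  by rewrite bE cE.
rewrite /vopair => E.
have Ex : x = x'.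
  have /in_vpair[/pp//|/esym/pe[-> //]] : vpair x x ∈ vpair (vpair x' x') (vpair x' y').
  by rewrite -E; apply/in_vpair; left.
by subst x'; split=> //; exact: pr (pr _ _ _ E).
Qed.

Lemma vsub_refl x : x ⊆ x. Proof. by []. Qed.
#[local] Hint Resolve vsub_refl : core.

Lemma vsub_antisym x y : x ⊆ y -> y ⊆ x -> x = y.
Proof. by move=> xy yx; apply: vext => z; split; [apply: xy|apply: yx]. Qed.

Lemma vmem_irrefl x : ~ x ∈ x.
Proof. by elim/vmem_ind: x => y IH yy; exact: (IH y yy yy). Qed.

Lemma elts_sub x y : x ⊆ y -> elts x #<= elts y.
Proof. by move=> xy; apply: subset_card_le. Qed.

(** * Ordinals *)

Lemma ord_trans a b c : is_ord a -> b ∈ a -> c ∈ b -> c ∈ a.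
Proof. by move=> [ta _] ba cb; apply: ta cb. Qed.

Lemma ord_mem a b : is_ord a -> b ∈ a -> is_ord b.
Proof.
move=> [ta ha] ba; split; first exact: ha.
by move=> c cb; apply: ha; apply: ta cb.
Qed.

Lemma ord_subset a b : is_ord a -> b ∈ a -> b ⊆ a.
Proof. by move=> [ta _]; apply: ta. Qed.

Lemma ord_tri a b : is_ord a -> is_ord b -> [\/ a ∈ b, a = b | b ∈ a].
Proof.
elim/vmem_ind: a b => a IHa b; elim/vmem_ind: b => b IHb oa ob.
have [[c ca cb]|nb] := pselect (exists2 c, c ∈ a & ~ c ∈ b).
  have := IHa c ca b (ord_mem oa ca) ob.
  move=> [//|<-|bc]; first by constructor 3.
  by constructor 3; apply: ord_trans bc.
have ab : a ⊆ b by move=> c ca; apply: contrapT => cb; apply: nb; exists c.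
have [[c cb ca]|na] := pselect (exists2 c, c ∈ b & ~ c ∈ a).
  have := IHb c cb oa (ord_mem ob cb).
  move=> [ac|->|//]; first by constructor 1; apply: ord_trans ac.
  by constructor 1.
have ba : b ⊆ a by move=> c ca; apply: contrapT => cb; apply: na; exists c.
by constructor 2; apply: vsub_antisym.
Qed.

Lemma ord_leVlt a b : is_ord a -> is_ord b -> a ⊆ b \/ b ∈ a.
Proof.
move=> oa ob; case: (ord_tri oa ob) => [ab|->|]; [|by left|by right].
by left; apply: ord_subset.
Qed.

Lemma ord_le a b : is_ord a -> is_ord b -> a ⊆ b -> a ∈ b \/ a = b.
Proof.
move=> oa ob ab; case: (ord_tri oa ob) => [||/ab/vmem_irrefl//]; by [left|right].
Qed.

Lemma ord_le_lt a b c : is_ord a -> is_ord c -> a ⊆ b -> b ∈ c -> a ∈ c.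
Proof.
move=> oa oc ab bc; have ob := ord_mem oc bc.
by have [/(ord_trans oc bc)//|->] := ord_le oa ob ab.
Qed.

Lemma ord_ltNle a b : is_ord a -> is_ord b -> ~ a ∈ b -> b ⊆ a.
Proof. by move=> oa ob nab; have [|] := ord_leVlt ob oa. Qed.

Lemma ord_leNlt a b : is_ord a -> is_ord b -> ~ a ⊆ b -> b ∈ a.
Proof. by move=> oa ob nab; have [|] := ord_leVlt oa ob. Qed.

Lemma max_in_ord d a b : is_ord d -> a ∈ d -> b ∈ d ->
  exists2 m, m ∈ d & a ⊆ m /\ b ⊆ m.
Proof.
move=> od ad bd; have [ab|ba] := ord_leVlt (ord_mem od ad) (ord_mem od bd).
  by exists b => //; split=> // z.
by exists a => //; split=> //; apply: ord_subset (ord_mem od ad) ba.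
Qed.

Lemma ord_intro (s : V) : is_trans s -> ords s -> is_ord s.
Proof. by move=> ts os; split=> // b /os[]. Qed.

Lemma ord_empty : is_ord vempty.
Proof. by split=> y /in_vempty. Qed.

Lemma ord_succ a : is_ord a -> is_ord (vsucc a).
Proof.
move=> oa; apply: ord_intro => [y /in_vsucc[ya|->] z zy|y /in_vsucc[|->//]].
- by apply/in_vsucc; left; apply: ord_trans zy.
- by apply/in_vsucc; left.
- exact: ord_mem.
Qed.

Lemma ord_succ_le a b : is_ord b -> a ∈ b -> vsucc a ⊆ b.
Proof. by move=> ob ab z /in_vsucc[za|->//]; apply: ord_trans za. Qed.

Lemma ord_min (P : V -> Prop) : (exists2 a, is_ord a & P a) ->
  exists a, [/\ is_ord a, P a & forall b, is_ord b -> P b -> a ⊆ b].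
Proof.
move=> [a oa Pa]; elim/vmem_ind: a oa Pa => a IH oa Pa.
have [[b ba Pb]|nb] := pselect (exists2 b, b ∈ a & P b).
  exact: IH ba (ord_mem oa ba) Pb.
exists a; split=> // b ob Pb; apply: ord_ltNle => // ba; by apply: nb; exists b.
Qed.

Lemma leastP (P : V -> Prop) : (exists2 a, is_ord a & P a) ->
  [/\ is_ord (least P), P (least P) & forall b, is_ord b -> P b -> least P ⊆ b].
Proof.
move=> /ord_min H.
exact: (@getPex _ [set a | [/\ is_ord a, P a & forall b, is_ord b -> P b -> a ⊆ b]]).
Qed.

Lemma burali_forti (s : V) : ~ (forall a, is_ord a -> a ∈ s).
Proof.
move=> H; have E := @in_vsep s is_ord H.
have : is_ord (vset is_ord).
  by apply: ord_intro => [y /E oy z zy|y /E//]; apply/E; apply: ord_mem zy.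
by move=> /E; apply: vmem_irrefl.
Qed.

(** * Recursion along [∈] *)

Lemma vmem_wf : well_founded vmem.
Proof. by elim/vmem_ind => x IH; constructor. Qed.

Lemma vrec (X : pointedType) (G : V -> (V -> X) -> X) :
  (forall a h h', (forall b, b ∈ a -> h b = h' b) -> G a h = G a h') ->
  exists K : V -> X, forall a, K a = G a K.
Proof.
move=> Gext.
(* By [Gext], [G] sees only the values below [a], so the partial function [r] may be extended by
   [point] elsewhere. *)
pose F a (r : forall b, b ∈ a -> X) :=
  G a (fun b => if pselect (b ∈ a) is left ba then r b ba else point).
exists (Fix vmem_wf (fun _ => X) F) => a.
rewrite Fix_eq; first by apply: Gext => b ba; case: pselect.
move=> x f g fg; congr (G x _); apply/funext => b.
by case: pselect => // bx.
Qed.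

(** * Cardinals *)

(** For an arbitrary choice function [ch] this well-orders [S]; choosing elements
    of minimal measure also bounds the length of the enumeration. *)
Lemma enum_ord (T : pointedType) (S : set T) (s : V) (ch : set T -> T) :
  S #<= elts s -> (forall U, U `<=` S -> U !=set0 -> U (ch U)) ->
  exists e (G : V -> T), [/\ is_ord e,
    forall a, a ∈ e -> G a = ch (S `\` G @` elts a),
    forall a, a ∈ e -> S (G a),
    forall a b, a ∈ e -> b ∈ e -> G a = G b -> a = b &
    forall x, S x -> exists2 a, a ∈ e & G a = x].
Proof.
move=> Ss chP.
have [G GE] : exists G : V -> T, forall a, G a = ch (S `\` G @` elts a).
  apply: vrec => a h h' hh'; congr (ch (S `\` _)).
  by apply/seteqP; split=> _ [b ba <-]; exists b => //; rewrite hh'.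
have Gin (a : V) : S `\` G @` elts a !=set0 -> (S `\` G @` elts a) (G a).
  by move=> ne; rewrite GE; apply: chP => // x [].
have Ginj (a b : V) : is_ord a -> is_ord b -> S `\` G @` elts a !=set0 ->
    S `\` G @` elts b !=set0 -> G a = G b -> a = b.
  move=> oa ob /Gin[_ na] /Gin[_ nb] E; case: (ord_tri oa ob) => // [ab|ba].
    by case: nb; exists a.
  by case: na; exists b.
have [e [oe]] : exists a, [/\ is_ord a, S `\` G @` elts a = set0 &
    forall b, is_ord b -> S `\` G @` elts b = set0 -> a ⊆ b].
  (* If [S] were never exhausted, [G] would inject the class of all ordinals into [s], and that
     class would be a set. *)
  apply: ord_min; apply: contrapT => ne.
  have ne0 a : is_ord a -> S `\` G @` elts a !=set0.
    by move=> oa; apply/set0P/eqP => E; apply: ne; exists a.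
  have E : [set a | is_ord a] #<= elts s.
    apply: card_le_trans Ss; apply: (@card_leI _ _ _ _ G).
      by move=> x ox; have [] := Gin x (ne0 x ox).
    by move=> x y ox oy; apply: Ginj => //; apply: ne0.
  apply: (@burali_forti (vset is_ord)) => a oa.
  by apply/(in_vset_card E).
move=> e0 emin.
have ne0 a : a ∈ e -> S `\` G @` elts a !=set0.
  move=> ae; apply/set0P/eqP => /(emin a (ord_mem oe ae))/(_ _ ae).
  exact: vmem_irrefl.
exists e, G; split=> //.
- by move=> a ae; have [] := Gin a (ne0 a ae).
- by move=> a b ae be; apply: Ginj; [apply: ord_mem ae|apply: ord_mem be|apply: ne0..].
- move=> x Sx; apply: contrapT => nx; have : (S `\` G @` elts e) x.
    by split=> // -[a ae E]; apply: nx; exists a.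
  by rewrite e0.
Qed.

Lemma card_ord_ex (x : V) : exists2 a, is_ord a & elts x #= elts a.
Proof.
have [U _ [u Uu]|e [G [oe _ Gin Ginj Gsurj]]] :=
  @enum_ord _ (elts x) x (fun U => xget vempty U) (card_lexx _).
  exact: xgetI Uu.
exists e => //; rewrite card_eq_sym card_eq_le; apply/andP; split.
  exact: (@card_leI _ _ _ _ G).
by apply/pcard_surjP; exists G => y /Gsurj[a ae <-]; exists a.
Qed.

Lemma vcardP x : is_card (vcard x) /\ elts x #= elts (vcard x).
Proof.
have [a oa xa] := card_ord_ex x.
have [oc xc cmin] : [/\ is_ord (vcard x), elts x #= elts (vcard x) &
   forall b, is_ord b -> elts x #= elts b -> vcard x ⊆ b].
  by apply: leastP; exists a.
split=> //; split=> // b bc bE; apply: (@vmem_irrefl b).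
apply: (cmin b (ord_mem oc bc) _ b bc).
by rewrite (card_eqr bE).
Qed.

Lemma is_card_vcard x : is_card (vcard x). Proof. by case: (vcardP x). Qed.
Lemma ord_vcard x : is_ord (vcard x). Proof. by case: (is_card_vcard x). Qed.
Lemma vcard_eqv x : elts x #= elts (vcard x). Proof. by case: (vcardP x). Qed.
Lemma ord_card k : is_card k -> is_ord k. Proof. by case. Qed.
#[local] Hint Resolve is_card_vcard ord_vcard : core.

Lemma vcard_le_ord x a : is_ord a -> elts x #<= elts a -> vcard x ⊆ a.
Proof.
move=> oa xa; apply: ord_ltNle => // ac.
have [_ /(_ a ac)] := is_card_vcard x; apply.
rewrite card_eq_le elts_sub /=; last exact: ord_subset.
by rewrite -(card_le_eql (vcard_eqv x)).
Qed.

Lemma le_vcard x a : (elts x #<= elts a) <-> vcard x ⊆ vcard a.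
Proof.
split=> [xa|/elts_sub]; last first.
  by rewrite -(card_le_eql (vcard_eqv x)) -(card_le_eqr (vcard_eqv a)).
by apply: vcard_le_ord => //; rewrite -(card_le_eqr (vcard_eqv a)).
Qed.

Lemma vcard_card k : is_card k -> vcard k = k.
Proof.
move=> kc; apply: vsub_antisym; first by apply: vcard_le_ord => //; apply: ord_card.
apply: ord_ltNle => //; first exact: ord_card.
by move=> ck; have [_ /(_ _ ck)] := kc; apply; rewrite card_eq_sym vcard_eqv.
Qed.

Lemma vcard_le k x : is_card k -> ((elts x #<= elts k) <-> vcard x ⊆ k).
Proof. by move=> kc; rewrite le_vcard (vcard_card kc). Qed.

Lemma vcard_ge k x : is_card k -> ((elts k #<= elts x) <-> k ⊆ vcard x).
Proof. by move=> kc; rewrite le_vcard (vcard_card kc). Qed.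

Lemma vcard_lt k x : is_card k -> (vcard x ∈ k <-> ~ (elts k #<= elts x)).
Proof.
move=> kc; rewrite (vcard_ge x kc); split=> [xk kx|]; last by apply: ord_leNlt (ord_card kc) _.
exact: vmem_irrefl (kx _ xk).
Qed.

Lemma vcard_eq k x : is_card k -> (vcard x = k <-> (elts x #= elts k)).
Proof.
move=> kc; split=> [<-|E]; first exact: vcard_eqv.
have /card_eqPle[xk kx] := E.
by apply: vsub_antisym; [apply/vcard_le|apply/vcard_ge].
Qed.

Lemma card_le_lt k x y : elts x #<= elts y -> is_card k -> vcard y ∈ k -> vcard x ∈ k.
Proof.
move=> xy kc /(vcard_lt _ kc) yk; apply/(vcard_lt _ kc) => kx; apply: yk.
exact: card_le_trans xy.
Qed.

Lemma mem_card_lt k a : is_card k -> a ∈ k -> vcard a ∈ k.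
Proof.
move=> kc ak; apply: (ord_le_lt (ord_vcard a) (ord_card kc) _ ak).
by apply: vcard_le_ord => //; apply: ord_mem (ord_card kc) ak.
Qed.

Lemma cantor x : ~ (elts (vpow x) #<= elts x).
Proof.
move=> /card_leS[g gs].
have DP := @in_vsep x (fun z => z ∈ x /\ ~ z ∈ g z) (fun z => @proj1 _ _).
have [|z zx gz] := gs (vset (fun z => z ∈ x /\ ~ z ∈ g z)).
  by apply/in_vpow => z /DP[].
have nz : ~ z ∈ g z by move=> zg; have := zg; rewrite gz => /DP[].
by apply: (nz); rewrite gz; apply/DP.
Qed.

Lemma lt_vpow k : is_card k -> k ∈ vcard (vpow k).
Proof.
move=> kc; apply: ord_leNlt => //; first exact: ord_card.
by move=> H; apply: (@cantor k); apply/vcard_le.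
Qed.

Lemma card_succP k : is_card k ->
  [/\ is_card k⁺, k ∈ k⁺ & forall m, is_card m -> k ∈ m -> k⁺ ⊆ m].
Proof.
move=> kc.
have [_ [kc' kk] kmin] : [/\ is_ord k⁺, is_card k⁺ /\ k ∈ k⁺ &
    forall m, is_ord m -> is_card m /\ k ∈ m -> k⁺ ⊆ m].
  by apply: leastP; exists (vcard (vpow k)) => //; split=> //; apply: lt_vpow.
by split=> // m mc km; apply: kmin => //; apply: ord_card.
Qed.

Lemma lt_card_succ k x : is_card k -> (vcard x ∈ k⁺ <-> (elts x #<= elts k)).
Proof.
move=> kc; have [kc' kk kmin] := card_succP kc; rewrite (vcard_le x kc).
split=> [xk|xk]; last exact: ord_le_lt (ord_card kc') xk kk.
apply: ord_ltNle => // [|kx]; first exact: ord_card.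
exact: vmem_irrefl (kmin _ (is_card_vcard x) kx _ xk).
Qed.

Lemma mem_card_succ k a : is_card k -> a ∈ k⁺ -> elts a #<= elts k.
Proof.
move=> kc ak; apply/lt_card_succ => //; apply: mem_card_lt => //.
by case: (card_succP kc).
Qed.

(** * Cofinality *)

Lemma cfP a : is_ord a -> [/\ is_card (cf a),
  exists2 c, is_cofinal c a & elts c #= elts (cf a) &
  forall c, is_cofinal c a -> cf a ⊆ vcard c].
Proof.
move=> oa; pose P b := exists2 c, is_cofinal c a & elts c #= elts b.
have Pc c : is_cofinal c a -> P (vcard c) by exists c => //; apply: vcard_eqv.
have [oc Pcf cmin] : [/\ is_ord (cf a), P (cf a) &
    forall b, is_ord b -> P b -> cf a ⊆ b].
  apply: leastP; exists (vcard a) => //; apply: Pc; split=> // b ba; by exists b.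
split=> [||c /Pc]; [|exact: Pcf|exact: cmin].
split=> // b bc bE; apply: (@vmem_irrefl b); apply: (cmin b (ord_mem oc bc) _ b bc).
by have [c cc cE] := Pcf; exists c => //; rewrite (card_eqr bE).
Qed.

Lemma cf_sub a : is_ord a -> cf a ⊆ a.
Proof.
move=> oa; have [_ _ H] := cfP oa; have : is_cofinal a a by split=> // b ba; exists b.
by move=> /H ca z /ca; apply: vcard_le_ord.
Qed.

Lemma bounded_cf d s : is_ord d -> vcard s ∈ cf d -> s ⊆ d ->
  exists2 b, b ∈ d & s ⊆ b.
Proof.
move=> od sd ssd; apply: contrapT => nb; have [_ _ H] := cfP od.
apply: (vmem_irrefl (H s _ _ sd)); split=> // b bd; apply: contrapT => nd.
apply: nb; exists b => // x xs; apply: ord_leNlt => //.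
- exact: ord_mem od bd.
- exact: ord_mem od (ssd _ xs).
- by move=> bx; apply: nd; exists x.
Qed.

Lemma bounded_fun d s (F : V -> V) : is_ord d -> vcard s ∈ cf d ->
  (forall i, i ∈ s -> F i ∈ d) -> exists2 b, b ∈ d & forall i, i ∈ s -> F i ∈ b.
Proof.
move=> od sd sF.
have [||b bd bP] := @bounded_cf d (vset (fun z => exists2 i, i ∈ s & z = F i)) od.
- have [cc _ _] := cfP od; apply: card_le_lt sd => //.
  apply: card_le_trans (card_image_le F (elts s)); apply: subset_card_le.
  by move=> y /in_vimage[i si ->]; exists i.
- by move=> y /in_vimage[i si ->]; apply: sF.
- by exists b => // i si; apply: bP; apply/in_vimage; exists i.
Qed.

(** An injection [h] of [t] into the union splits [t] into pieces [A i]. By regularity each piece is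
    bounded in [t], and so are the bounds, by some [c]; but [c] lies in a piece itself. *)
Lemma regular_bigcup t w (F : V -> V) : is_regular t -> vcard w ∈ t ->
  (forall i, i ∈ w -> vcard (F i) ∈ t) -> vcard (vbigcup w F) ∈ t.
Proof.
move=> [[tc _] tr] wt Ft; have ot := ord_card tc.
apply/vcard_lt => // /card_leE[h [hin hinj]].
pose A i := vset (fun a => a ∈ t /\ h a ∈ F i).
have AP i a : a ∈ A i <-> a ∈ t /\ h a ∈ F i by apply: (@in_vsep t) => z [].
have /choice[b bP] : forall i, exists b, i ∈ w -> b ∈ t /\ A i ⊆ b.
  move=> i.
  have [iw|niw] := pselect (i ∈ w); last by exists i.
  have [||b bt Ab] := @bounded_cf t (A i) ot; last by exists b.
    rewrite tr; apply: (@card_le_lt _ _ (F i)) => //; last exact: Ft.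
    apply: (@card_leI _ _ _ _ h) => [x /AP[]//|x y /AP[xt _] /AP[yt _]].
    exact: hinj.
  by move=> a /AP[].
have [||c ct cP] := @bounded_fun t w b ot.
- by rewrite tr.
- by move=> i /bP[].
have [i iw hi] := (in_vbigcup _ _ _).1 (hin c ct).
have /(proj2 (bP i iw)) cb : c ∈ A i by apply/AP.
apply: (@vmem_irrefl c); apply: ord_trans cb; last exact: cP.
exact: ord_mem ct.
Qed.

Lemma card_le_bigcup (I X : Type) (U W : pointedType) (A : set I)
    (F : I -> set X) (B : set U) (C : set W) :
  A #<= B -> (forall i, A i -> F i #<= C) -> \bigcup_(i in A) F i #<= B `*` C.
Proof.
move=> /card_leE[f [fin finj]] FC.
have /choice[g gP] : forall i, exists g : X -> W, A i ->
    (forall x, F i x -> C (g x)) /\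
    (forall x y, F i x -> F i y -> g x = g y -> x = y).
  move=> i; have [Ai|nAi] := pselect (A i); last by exists (fun=> point).
  by have /card_leE[g gP] := FC i Ai; exists g.
have /choice[h hP] : forall x, exists u : U * W, (\bigcup_(i in A) F i) x ->
    exists i, [/\ A i, F i x & u = (f i, g i x)].
  move=> x; have [[i Ai Fi]|nx] := pselect ((\bigcup_(i in A) F i) x).
    by exists (f i, g i x) => _; exists i.
  by exists point.
apply: (@card_leI _ _ _ _ h) => [x /hP[i [Ai Fi ->]]|x y /hP[i [Ai Fi ->]] /hP[j [Aj Fj ->]]].
  by split=> /=; [apply: fin|apply: (gP i Ai).1].
by move=> [fij]; have ij := finj _ _ Ai Aj fij; subst j; apply: (gP i Ai).2.
Qed.

(** Enumerate [S] choosing an element of least measure each time. If the enumeration went past [l],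
    the first [l] elements would all have measure at most that of [G l], which was still available
    when they were chosen. *)
Lemma card_le_measure (T : pointedType) (S : set T) (s l : V) (m : T -> V) :
  is_card l -> S #<= elts s -> (forall p, S p -> m p ∈ l) ->
  (forall u, u ∈ l -> ~ (elts l #<= [set p | S p /\ m p ⊆ u])) -> S #<= elts l.
Proof.
move=> lc Ss ml mu; have ol := ord_card lc.
pose Q (U : set T) := [set u | U u /\ forall v, U v -> m u ⊆ m v].
have QP U : U `<=` S -> U !=set0 -> Q U (xget point (Q U)).
  move=> US [u0 Uu0]; apply: xgetPex.
  have [|a [oa [u Uu ua] amin]] := @ord_min (fun a => exists2 u, U u & m u = a).
    by exists (m u0); [apply: ord_mem ol (ml _ (US _ Uu0))|exists u0].
  exists u; split=> // v Uv; rewrite ua; apply: amin; last by exists v.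
  exact: ord_mem ol (ml _ (US _ Uv)).
have [U US U0|e [G [oe Gdef Gin Ginj Gsurj]]] :=
    @enum_ord _ S s (fun U => xget point (Q U)) Ss.
  by have [] := QP U US U0.
have Se : S #<= elts e by apply/pcard_surjP; exists G => y /Gsurj[a]; exists a.
apply: card_le_trans Se _; apply: elts_sub.
apply: ord_ltNle => // le.
apply: (mu (m (G l))); first by apply: ml; apply: Gin.
apply: (@card_leI _ _ _ _ G) => [b bl|a b al bl]; last first.
  by apply: Ginj; apply: (ord_trans oe le).
have be : b ∈ e by apply: ord_trans bl.
split; first exact: Gin.
rewrite (Gdef b be); set U := S `\` _.
have UG : U (G l).
  split; first exact: Gin.
  move=> [c cb Gcl]; have cl : c ∈ l by apply: ord_trans cb.
  have := Ginj c l (ord_trans oe le cl) le Gcl => E; rewrite E in cl.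
  exact: vmem_irrefl cl.
by have [_] := QP U (fun x => @proj1 _ _) (ex_intro _ _ UG); apply.
Qed.

Lemma card_vpow x y : elts x #<= elts y -> elts (vpow x) #<= elts (vpow y).
Proof.
move=> /card_leE[f [fin finj]].
apply: (@card_leI _ _ _ _ (fun u => vset (fun z => exists2 i, i ∈ u & z = f i))).
  by move=> u /in_vpow ux; apply/in_vpow => z /in_vimage[i /ux ix ->]; apply: fin.
have sub u v : u ⊆ x -> v ⊆ x -> vset (fun z => exists2 i, i ∈ u & z = f i) =
    vset (fun z => exists2 i, i ∈ v & z = f i) -> u ⊆ v.
  move=> ux vx E z zu.
  have /in_vimage[i iv fzi] : f z ∈ vset (fun z => exists2 i, i ∈ v & z = f i).
    by rewrite -E; apply/in_vimage; exists z.
  by rewrite (finj z i) //; [apply: ux|apply: vx].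
move=> u v /in_vpow ux /in_vpow vx E.
by apply: vsub_antisym; apply: sub.
Qed.

Lemma vopair_pow x a b : a ∈ x -> b ∈ x -> vopair a b ∈ vpow (vpow x).
Proof.
move=> ax bx; apply/in_vpow => y /in_vpair[]->; apply/in_vpow => z /in_vpair[]-> //.
Qed.

(** A crude bound, good enough below a strong limit, which absorbs power sets. *)
Lemma card_setX_pow x : elts x `*` elts x #<= elts (vpow (vpow x)).
Proof.
apply: (@card_leI _ _ _ _ (fun p => vopair p.1 p.2)).
  by move=> [a b] [/= ax bx]; apply: vopair_pow.
by move=> [a b] [c d] _ _ /= /vopair_inj[-> ->].
Qed.

(** * Cardinal arithmetic at a strong limit *)

Section StrongLimit.

Variables (l : V) (lsl : is_strong_limit l).

Let lc : is_card l. Proof. by case: lsl => -[]. Qed.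
Let ol : is_ord l. Proof. exact: ord_card lc. Qed.
Let sc : is_card l⁺. Proof. by case: (card_succP lc). Qed.
Let os : is_ord l⁺. Proof. exact: ord_card sc. Qed.

Lemma vpow_lt x : vcard x ∈ l -> vcard (vpow x) ∈ l.
Proof.
move=> xl; case: lsl => _ /(_ _ xl); apply: card_le_lt => //.
apply: card_vpow; have := vcard_eqv x; by rewrite card_eq_le => /andP[].
Qed.

(** If [vsucc a] were [l], the power set of [a] would have cardinality at most [a], against
    Cantor. *)
Lemma succ_lt a : a ∈ l -> vsucc a ∈ l.
Proof.
move=> al; have oa := ord_mem ol al.
have [//|E] := ord_le (ord_succ oa) ol (ord_succ_le ol al).
have : vcard (vpow a) ∈ l by apply: vpow_lt; apply: mem_card_lt.
rewrite -{1}E => /in_vsucc H; exfalso; apply: (@cantor a).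
rewrite (card_le_eql (vcard_eqv _)); apply: elts_sub.
by case: H => [H|->//]; apply: ord_subset H.
Qed.

Lemma setX_lt m : m ∈ l -> vcard (vpow (vpow m)) ∈ l.
Proof. by move=> ml; do 2!apply: vpow_lt; apply: mem_card_lt. Qed.

(** Measure a pair by an upper bound of its coordinates below [l]. The pairs of measure at most [u]
    lie in the square of [vsucc u], which is smaller than the strong limit [l], so [card_le_measure]
    applies. *)
Lemma card_le_lsetX : elts l `*` elts l #<= elts l.
Proof.
have /choice[m mP] : forall p : V * V, exists u, p.1 ∈ l -> p.2 ∈ l ->
    u ∈ l /\ p.1 ⊆ u /\ p.2 ⊆ u.
  move=> [a b] /=; have [[al bl]|n] := pselect (a ∈ l /\ b ∈ l).
    by have [u] := max_in_ord ol al bl; exists u.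
  by exists a => al bl; case: n.
apply: (@card_le_measure _ _ (vpow (vpow l)) l m) => //.
- exact: card_setX_pow.
- by move=> p [/(mP p) H /H[]].
- move=> u ul H; have /(vcard_lt _ lc) := setX_lt (succ_lt ul); apply.
  apply: card_le_trans H _; apply: card_le_trans (card_setX_pow _).
  apply: subset_card_le => -[a b] [[/= al bl] mu].
  have [ml [am bm]] := mP (a, b) al bl.
  have ou := ord_mem ol ul.
  split; apply: ord_le_lt (vsucc_refl u); rewrite /=.
  + exact: ord_mem al.
  + exact: ord_succ.
  + by move=> z /am/mu.
  + exact: ord_mem bl.
  + exact: ord_succ.
  + by move=> z /bm/mu.
Qed.

Lemma card_le_lbigcup (I X : Type) (A : set I) (F : I -> set X) :
  A #<= elts l -> (forall i, A i -> F i #<= elts l) ->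
  \bigcup_(i in A) F i #<= elts l.
Proof.
by move=> Al Fl; apply: card_le_trans card_le_lsetX; apply: card_le_bigcup.
Qed.

Lemma nat_le : [set: nat] #<= elts l.
Proof. by apply/infiniteP; case: lsl => -[]. Qed.

Lemma card_le_lbigcupT (I : countType) (X : Type) (F : I -> set X) :
  (forall i, F i #<= elts l) -> \bigcup_i F i #<= elts l.
Proof.
move=> Fl; apply: card_le_lbigcup => //; apply: card_le_trans nat_le.
by apply: (@card_leI _ _ _ _ pickle) => // x y _ _ /(pcan_inj pickleK).
Qed.

Lemma card_le_lsetU (X : Type) (A B : set X) :
  A #<= elts l -> B #<= elts l -> A `|` B #<= elts l.
Proof.
move=> Al Bl; apply: card_le_trans (@card_le_lbigcupT bool _ (fun b => if b then A else B) _).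
  by apply: subset_card_le => x [?|?]; [exists true|exists false].
by case.
Qed.

Lemma card_le_lset1 (X : Type) (x : X) : [set x] #<= elts l.
Proof.
apply: card_le_trans nat_le.
by apply: (@card_leI _ _ _ _ (fun=> 0%N)) => // a b -> ->.
Qed.

Lemma succ_le a : elts a #<= elts l -> elts (vsucc a) #<= elts l.
Proof.
move=> al; apply: (@card_le_trans _ _ _ (elts a `|` [set a])).
  by apply: subset_card_le => z /in_vsucc.
by apply: card_le_lsetU => //; apply: card_le_lset1.
Qed.

Lemma vbigcup_le w F : elts w #<= elts l ->
  (forall i, i ∈ w -> elts (F i) #<= elts l) -> elts (vbigcup w F) #<= elts l.
Proof.
move=> wl Fl; apply: card_le_trans (card_le_lbigcup wl Fl).
by apply: subset_card_le => x /in_vbigcup[i]; exists i.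
Qed.

(** As [l] may be singular, sizes below [l] alone would not do: the common bound [m] puts the union
    into a product of two sets below [l]. *)
Lemma vbigcup_lt w F m : m ∈ l -> vcard w ∈ l ->
  (forall i, i ∈ w -> elts (F i) #<= elts m) -> vcard (vbigcup w F) ∈ l.
Proof.
move=> ml wl Fm; have [n nl [wn mn]] := max_in_ord ol wl ml.
apply: card_le_lt (setX_lt nl) => //; apply: card_le_trans (card_setX_pow _).
have wn' : elts w #<= elts n.
  by rewrite (card_le_eql (vcard_eqv _)); apply: elts_sub.
have Fn i : i ∈ w -> elts (F i) #<= elts n.
  by move=> /Fm/card_le_trans; apply; apply: elts_sub.
apply: card_le_trans (card_le_bigcup wn' Fn).
by apply: subset_card_le => x /in_vbigcup[i]; exists i.
Qed.

(** A cofinal set of size at most [l] would cover [l⁺] by at most [l] ordinals of size at most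
    [l]. *)
Lemma cf_lsucc : cf l⁺ = l⁺.
Proof.
have [kc [c [csub cc] cE] _] := cfP os.
apply: vsub_antisym; first exact: cf_sub.
apply: ord_ltNle => // [|cl]; first exact: ord_card.
have ll : elts (cf l⁺) #<= elts l by apply: mem_card_succ.
have : vcard l⁺ ∈ l⁺.
  apply/lt_card_succ => //; apply: card_le_trans (@vbigcup_le c vsucc _ _).
  - apply: subset_card_le => b bl; have [d dc bd] := cc b bl.
    apply/in_vbigcup; exists d => //; apply/in_vsucc.
    exact: ord_le (ord_mem os bl) (ord_mem os (csub _ dc)) bd.
  - by rewrite (card_le_eql cE).
  - by move=> d /csub dl; apply: succ_le; apply: mem_card_succ.
rewrite vcard_card //; exact: vmem_irrefl.
Qed.

Lemma lsucc_succ a : a ∈ l⁺ -> vsucc a ∈ l⁺.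
Proof.
move=> al; have oa := ord_mem os al.
have [//|E] := ord_le (ord_succ oa) os (ord_succ_le os al).
have /(lt_card_succ _ lc) : elts (vsucc a) #<= elts l by apply: succ_le; apply: mem_card_succ.
by rewrite E vcard_card // => /vmem_irrefl.
Qed.

Lemma card_le_lseq (A : set V) : A #<= elts l ->
  [set s : seq V | forall x, x \in s -> A x] #<= elts l.
Proof.
move=> Al; pose S n := [set s : seq V | size s = n /\ forall x, x \in s -> A x].
have H n : S n #<= elts l.
  elim: n => [|n IH].
    apply: card_le_trans (card_le_lset1 (@nil V)).
    by apply: subset_card_le => s [] /size0nil ->.
  apply: card_le_trans (card_le_lbigcup Al (fun x _ =>
    card_le_trans (card_image_le (cons x) (S n)) IH)).
  apply: subset_card_le => -[|x s] [//= [sn] sA].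
  exists x; first by apply: sA; rewrite inE eqxx.
  by exists s => //; split=> // y ys; apply: sA; rewrite inE ys orbT.
apply: card_le_trans (card_le_lbigcupT H); apply: subset_card_le => s sA.
by exists (size s).
Qed.

End StrongLimit.

(** * Collapses of sets of ordinals *)

Lemma collapse_ex (x : V) : exists K : V -> V, forall a z,
  z ∈ K a <-> exists c, [/\ c ∈ x, c ∈ a & z = K c].
Proof.
have [K KE] : exists K : V -> V, forall a,
    K a = vset (fun z => exists2 c, c ∈ vcap x a & z = K c).
  apply: vrec => a h h' hh'; congr vset; apply/funext => z; apply/propext.
  by split=> -[c cx ->]; exists c => //; have /in_vcap[_ /hh'] := cx.
exists K => a z; rewrite KE in_vimage; split.
  by move=> [c /in_vcap[cx ca] ->]; exists c.
by move=> [c [cx ca ->]]; exists c => //; apply/in_vcap.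
Qed.

(** The Mostowski collapse of [x], extended to all arguments: at an ordinal [a] its value is the
    order type of the part of [x] below [a]. *)
Definition collapse (x : V) : V -> V := sval (cid (collapse_ex x)).

Lemma collapseP x a z :
  z ∈ collapse x a <-> exists c, [/\ c ∈ x, c ∈ a & z = collapse x c].
Proof. by rewrite /collapse; case: cid => K /= ->. Qed.

Lemma ord_collapse x a : is_ord a -> is_ord (collapse x a).
Proof.
elim/vmem_ind: a => a IH oa; apply: ord_intro => [y|y] /collapseP[c [cx ca ->]].
  move=> z /collapseP[c' [c'x c'c ->]]; apply/collapseP; exists c'; split=> //.
  exact: ord_trans ca c'c.
by apply: IH => //; apply: ord_mem ca.
Qed.

Lemma collapse_lt x a b : a ∈ x -> a ∈ b -> collapse x a ∈ collapse x b.
Proof. by move=> ax ab; apply/collapseP; exists a. Qed.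

Lemma collapse_le x a b : is_ord a -> is_ord b -> b ∈ x ->
  collapse x a ⊆ collapse x b -> a ⊆ b.
Proof.
move=> oa ob bx H; apply: ord_ltNle => // ba.
exact: vmem_irrefl (H _ (collapse_lt bx ba)).
Qed.

(** The recursion at [a] looks only at members of [x] below [a]. Hence ranks in [x] can be read off
    from an initial segment of [x]. *)
Lemma collapse_cap x a b : is_ord b -> a ⊆ b -> collapse (vcap x b) a = collapse x a.
Proof.
move=> ob; elim/vmem_ind: a => a IH ab; apply: vext => z; rewrite !collapseP; split.
  move=> [c [/in_vcap[cx cb] ca ->]]; exists c; split=> //.
  by apply: IH => //; apply: ord_subset cb.
move=> [c [cx ca ->]]; exists c; split=> //; first by apply/in_vcap; split=> //; apply: ab.
by apply/esym/IH => //; apply: ord_subset (ab _ ca).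
Qed.

Lemma collapse_inj x a b : ords x -> a ∈ x -> b ∈ x -> collapse x a = collapse x b -> a = b.
Proof.
move=> ox ax bx E.
by apply: vsub_antisym; apply: (@collapse_le x); rewrite ?E //; apply: ox.
Qed.

(** The collapse shows that an order type exists; by induction any order isomorphism of [x] onto an
    ordinal agrees with the collapse on [x]. *)
Lemma otp_collapse x d : is_ord d -> x ⊆ d -> otp x = collapse x d.
Proof.
move=> od xd; have ox : ords x by move=> a /xd; apply: ord_mem.
have [oe [f [[fin finj fsurj] ford]]] : is_ord (otp x) /\ exists f : V -> V,
    set_bij (elts x) (elts (otp x)) f /\
    forall b c, b ∈ x -> c ∈ x -> b ∈ c -> f b ∈ f c.
  apply: (@getPex _ [set a | is_ord a /\ exists f : V -> V, set_bij (elts x) (elts a) f /\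
      forall b c, b ∈ x -> c ∈ x -> b ∈ c -> f b ∈ f c]).
  exists (collapse x d); split; first exact: ord_collapse.
  exists (collapse x); split=> [|b c bx cx]; last exact: collapse_lt.
  split=> [b bx|b c /set_mem bx /set_mem cx|z /collapseP[c [cx cd ->]]].
  - by apply: collapse_lt => //; apply: xd.
  - exact: collapse_inj.
  - by exists c.
have fE b : b ∈ x -> f b = collapse x b.
  elim/vmem_ind: b => b IH bx; apply: vext => z; rewrite collapseP; split.
    move=> zfb; have /fsurj[c cx fcz] : z ∈ otp x by apply: ord_trans zfb => //; apply: fin.
    have cb : c ∈ b.
      have [//|E|bc] := ord_tri (ox c cx) (ox b bx).
        by move: zfb; rewrite -E fcz => /vmem_irrefl.
      have := ford b c bx cx bc; rewrite fcz => H.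
      exfalso; apply: (@vmem_irrefl z); apply: ord_trans H zfb.
      by apply: ord_mem oe _; rewrite -fcz; apply: fin.
    by exists c; split=> //; rewrite -fcz; apply: IH.
  by move=> [c [cx cb ->]]; rewrite -IH //; apply: ford.
apply: vext => z; rewrite collapseP; split.
  by move=> /fsurj[c cx <-]; exists c; split=> //; [apply: xd|apply: fE].
by move=> [c [cx _ ->]]; rewrite -fE //; apply: fin.
Qed.

(** * Approachability *)

(** For a cardinal [t] this expresses order type at most [t] by cardinalities alone, a form easily
    inherited by subsets. *)
Definition thin_cofinal (t z d : V) : Prop :=
  [/\ is_cofinal z d, elts z #<= elts t & forall b, b ∈ d -> vcard (vcap z b) ∈ t].

Definition approachable (l t : V) : Prop :=
  exists P : V -> V, (forall g, g ∈ l⁺ -> elts (P g) #<= elts l) /\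
    forall d, d ∈ l⁺ -> cf d = t -> exists2 z, thin_cofinal t z d &
      forall b, b ∈ d -> exists2 g, g ∈ d & vcap z b ∈ P g.

(** Enumerate a cofinal set along [t] and keep the values exceeding all earlier ones. They are
    cofinal, since the first value reaching a given bound is such a record; and the records below
    [f n] have indices below [n]. *)
Lemma thin_cofinal_ex t d : is_card t -> is_ord d -> cf d = t ->
  exists z, thin_cofinal t z d.
Proof.
move=> tc od dt; have ot := ord_card tc.
have [_ [c [cd cc] cE] _] := cfP od.
have [f [fin finj fsurj]] : exists f : V -> V, [/\ forall x, x ∈ t -> f x ∈ c,
    forall x y, x ∈ t -> y ∈ t -> f x = f y -> x = y &
    forall y, y ∈ c -> exists2 x, x ∈ t & f x = y].
  by apply: card_eqE; rewrite card_eq_sym -dt.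
pose z := vset (fun y => exists n, [/\ n ∈ t, y = f n & forall m, m ∈ n -> f m ∈ f n]).
have zP y : y ∈ z <-> exists n, [/\ n ∈ t, y = f n & forall m, m ∈ n -> f m ∈ f n].
  by apply: (@in_vsep c) => w [n [nt -> _]]; apply: fin.
have of_ n : n ∈ t -> is_ord (f n) by move=> /fin/cd; apply: ord_mem.
have fE b : b ∈ d -> exists2 n, n ∈ t & b ⊆ f n.
  by move=> /cc[y /fsurj[n nt <-] bn]; exists n.
exists z; split.
- split=> [y /zP[n [nt -> _]]|b bd]; first exact/cd/fin.
  have [|n [on [nt bn] nmin]] := @ord_min (fun n => n ∈ t /\ b ⊆ f n).
    by have [n nt bn] := fE b bd; exists n => //; apply: ord_mem nt.
  exists (f n) => //; apply/zP; exists n; split=> // m mn.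
  have mt : m ∈ t by apply: ord_trans mn.
  apply: bn; apply: ord_leNlt (ord_mem od bd) (of_ m mt) _ => bm.
  exact: vmem_irrefl (nmin m (ord_mem ot mt) (conj mt bm) _ mn).
- apply: card_le_trans (card_image_le f (elts t)); apply: subset_card_le.
  by move=> y /zP[n [nt -> _]]; exists n.
- move=> b bd; have [n nt bn] := fE b bd.
  apply: (@card_le_lt _ _ n) => //; last exact: mem_card_lt.
  apply: card_le_trans (card_image_le f (elts n)); apply: subset_card_le.
  move=> y /in_vcap[/zP[m [mt -> mlt]] fmb]; exists m => //.
  apply: ord_leNlt => // [||nm]; [exact: ord_mem nt|exact: ord_mem mt|].
  have [nm'|E] := ord_le (ord_mem ot nt) (ord_mem ot mt) nm.
    by apply: (@vmem_irrefl (f n)); apply: ord_trans (of_ n nt) (bn _ fmb) (mlt _ nm').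
  by move: (bn _ fmb); rewrite E => /vmem_irrefl.
Qed.

Lemma thin_cofinal_card t z d : is_ord d -> cf d = t -> thin_cofinal t z d ->
  elts z #= elts t.
Proof.
move=> od dt [zd zt _]; have [tc _ H] := cfP od; rewrite dt in tc H.
by rewrite card_eq_le zt; apply/vcard_ge => //; apply: H.
Qed.

(** A set [J] of size [t] does not fit into a proper initial segment of [z], so it stays cofinal. *)
Lemma thin_cofinal_sub t z d J : is_card t -> is_ord d -> thin_cofinal t z d ->
  J ⊆ z -> elts J #= elts t -> thin_cofinal t J d.
Proof.
move=> tc od [[zd zc] zt zb] Jz Jt; split.
- split=> [y /Jz/zd//|b bd]; apply: contrapT => nb.
  have /(vcard_lt _ tc) := zb b bd; apply.
  have /card_eqPle[_ /card_le_trans] := Jt; apply; apply: elts_sub => y yJ.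
  apply/in_vcap; split; first exact: Jz.
  apply: ord_leNlt (ord_mem od bd) (ord_mem od (zd _ (Jz _ yJ))) _ => bY.
  by apply: nb; exists y.
- by have /card_eqPle[] := Jt.
- move=> b bd; apply: card_le_lt (zb b bd) => //; apply: elts_sub => y.
  by move=> /in_vcap[yJ yb]; apply/in_vcap; split=> //; apply: Jz.
Qed.

Lemma infinite_set1F (x : V) (t : V) : infinite_set (elts t) ->
  ~ (elts t #<= [set x]).
Proof.
move=> ti H; apply: ti; exact: card_le_finite H (finite_set1 x).
Qed.

Lemma cf_limit t d : is_regular t -> is_ord d -> cf d = t -> is_limit d.
Proof.
move=> [[tc ti] _] od dt; split=> //.
  move=> d0; have [x tx] : elts t !=set0.
    by apply/set0P/eqP => E; apply: ti; rewrite E; apply: finite_set0.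
  by have := cf_sub od; rewrite dt d0 => /(_ _ tx)/in_vempty.
move=> b bd; have ob := ord_mem od bd.
have [//|E] := ord_le (ord_succ ob) od (ord_succ_le od bd).
exfalso; apply: (@infinite_set1F b t) => //; rewrite -dt.
have [cc _ H] := cfP od.
have /H /(vcard_ge _ cc) : is_cofinal (vpair b b) d.
  split=> [y /in_vpair[] -> //|c]; rewrite -E => /in_vsucc cb.
  exists b; first by apply/in_vpair; left.
  by case: cb => [/(ord_subset ob)//|->].
by move=> /card_le_trans; apply; apply: subset_card_le => y /in_vpair[] ->.
Qed.

Lemma in_Scof k t a : a ∈ Scof k t <-> a ∈ k /\ cf a = t.
Proof. by apply: (@in_vsep k) => z []. Qed.

Lemma in_approach A k : A ∈ approach_ideal k <-> [/\ A ⊆ k,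
   ~ is_stationary (vset (fun d => d ∈ A /\ d = cf d)) k &
   exists P : V -> V,
          (forall a, a ∈ k ->
             vcard (P a) ∈ k /\ forall x, x ∈ P a -> x ⊆ a) /\
          (forall a, a ∈ A -> is_limit a -> cf a ∈ a ->
             exists x,
               [/\ x ⊆ a, otp x ∈ a, vunion x = a &
                   forall b, b ∈ a -> vcap x b ∈ vbigcup a P])].
Proof. by apply: (@in_vsep (vpow k)) => z [zk _ _]; apply/in_vpow. Qed.

Lemma in_vdiag A d : d ∈ vset (fun d => d ∈ A /\ d = cf d) <-> d ∈ A /\ d = cf d.
Proof. by apply: (@in_vsep A) => z []. Qed.

(** * Approachability against the ideal, [Pr'] and [Sp] *)

Section Approach.

Variables (l t : V) (lsl : is_strong_limit l) (treg : is_regular t) (tl : t ∈ l).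

Let lc : is_card l. Proof. by case: lsl => -[]. Qed.
Let sc : is_card l⁺. Proof. by case: (card_succP lc). Qed.
Let os : is_ord l⁺. Proof. exact: ord_card sc. Qed.
Let tc : is_card t. Proof. by case: treg => -[]. Qed.
Let ot : is_ord t. Proof. exact: ord_card tc. Qed.
Let ll : l ∈ l⁺. Proof. by case: (card_succP lc). Qed.
Let ts : t ∈ l⁺. Proof. exact: ord_trans ll tl. Qed.

Lemma approachable_ideal : approachable l t -> Scof l⁺ t ∈ approach_ideal l⁺.
Proof.
move=> [P [Pl Pd]]; apply/in_approach; split=> [a /in_Scof[]//||].
  (* A member of [Scof l⁺ t] equal to its own cofinality is [t], so the club of ordinals above [t]
     misses the regular part. *)
  move=> /(_ (vset (fun a => a ∈ l⁺ /\ t ∈ a))).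
  have CP a : a ∈ vset (fun a => a ∈ l⁺ /\ t ∈ a) <-> a ∈ l⁺ /\ t ∈ a.
    by apply: (@in_vsep l⁺) => z [].
  case=> [|a /in_vdiag[/in_Scof[_ at_] ac] /CP[_]]; last first.
    by rewrite ac at_ => /vmem_irrefl.
  split=> [|d dl [od d0 _] [_ dc]].
    split=> [a /CP[]//|b bl]; have [m ml [tm bm]] := max_in_ord os ts bl.
    exists (vsucc m); last by move=> z /bm zm; apply: sub_vsucc.
    apply/CP; split; first exact: lsucc_succ.
    apply: ord_le_lt tm (vsucc_refl m) => //.
    by apply: ord_succ; apply: ord_mem ml.
  apply/CP; split=> //.
  have [b bd] : exists b, b ∈ d.
    by apply: contrapT => n; apply: d0; apply: vsub_antisym => b bd; [case: n; exists b|
      case: (in_vempty bd)].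
  by have [c /in_vcap[/CP[_ tc'] cd] _] := dc b bd; apply: ord_trans tc'.
(* The families up to stage [g], cut down to subsets of [g]. The segment of [z] below [b],
   enumerated at [g], appears at the maximum of [g] and [b]. *)
exists (fun g => vset (fun w => w ∈ vbigcup (vsucc g) P /\ w ⊆ g)).
have QP g w : w ∈ vset (fun w => w ∈ vbigcup (vsucc g) P /\ w ⊆ g) <->
    w ∈ vbigcup (vsucc g) P /\ w ⊆ g by apply: (@in_vsep (vbigcup (vsucc g) P)) => v [].
split=> [g gl|d /in_Scof[dl dt] dlim cd].
  split=> [|x /QP[]//]; apply/lt_card_succ => //.
  apply: card_le_trans (@vbigcup_le _ lsl (vsucc g) P _ _).
  - by apply: elts_sub => x /QP[].
  - by apply: succ_le => //; apply: mem_card_succ.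
  - move=> i /in_vsucc[ig|->]; apply: Pl => //; exact: ord_trans ig.
have od := ord_mem os dl.
have [z zthin zP] := Pd d dl dt; have [[zd zc] zt zb] := zthin.
exists z; split=> //.
(* By thinness every proper initial segment of [z] collapses to an ordinal below [t], so [otp z] is
   at most [t = cf d], which is below [d]. *)
- rewrite (otp_collapse od zd).
  apply: (@ord_le_lt _ t) => //; first exact: ord_collapse; last by rewrite -dt.
  move=> a /collapseP[c [cz cd' ->]].
  have oc := ord_mem od cd'.
  have : vcard (collapse z c) ∈ t.
    apply: card_le_lt (zb c cd') => //.
    apply: card_le_trans (card_image_le (collapse z) _); apply: subset_card_le.
    by move=> a' /collapseP[c' [c'z c'c ->]]; exists c' => //; apply/in_vcap.
  move=> H; apply: ord_leNlt => //; first exact: ord_collapse.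
  move=> /elts_sub /(vcard_ge _ tc) tC; exact: vmem_irrefl (tC _ H).
- apply: vsub_antisym => [b /in_vunion[y /zd yd by_]|b bd].
    exact: ord_trans by_.
  have [_ _ /(_ _ bd) sbd] := dlim; have [y yz sy] := zc _ sbd.
  by apply/in_vunion; exists y => //; apply: sy; apply: vsucc_refl.
- move=> b bd; have [g gd zg] := zP b bd.
  have [m md [gm bm]] := max_in_ord od gd bd.
  apply/in_vbigcup; exists m => //; apply/QP; split; last by move=> w /in_vcap[_ /bm].
  apply/in_vbigcup; exists g => //; apply/in_vsucc.
  exact: ord_le (ord_mem od gd) (ord_mem od md) gm.
Qed.

(** A witness [x] at [d] has an order type [a] below [d], of cofinality [t]. Thinning [x] along a
    fixed thin cofinal subset [e a] of [a] gives a thin cofinal subset of [d], whose initial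
    segments are computed from [a] and initial segments of [x], all available before [d]. *)
Lemma ideal_approachable : Scof l⁺ t ∈ approach_ideal l⁺ -> approachable l t.
Proof.
move=> /in_approach[_ _ [P [Pl Pd]]].
have /choice[e eP] : forall a, exists e, is_ord a -> cf a = t -> thin_cofinal t e a.
  move=> a; have [[oa at_]|n] := pselect (is_ord a /\ cf a = t); last first.
    by exists a => oa at_; case: n.
  by have [e] := thin_cofinal_ex tc oa at_; exists e.
pose sel w e' := vset (fun x => x ∈ w /\ collapse w x ∈ e').
have selP w e' x : x ∈ sel w e' <-> x ∈ w /\ collapse w x ∈ e'.
  by apply: (@in_vsep w) => y [].
(* The alternative [w = g] serves the case that [cf d] is not below [d]: then [d] is [t], its own
   thin cofinal set, and the initial segments are ordinals. *)
pose Q g w := w = g \/ exists w' a,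
  [/\ w' ∈ vbigcup (vsucc g) P, a ∈ vsucc g & w = sel w' (e a)].
have Ql g : g ∈ l⁺ -> [set w | Q g w] #<= elts l.
  move=> gl; have gl' : elts (vsucc g) #<= elts l.
    by apply: succ_le => //; apply: mem_card_succ.
  have Pgl : elts (vbigcup (vsucc g) P) #<= elts l.
    apply: vbigcup_le => // i ig.
    apply/(lt_card_succ _ lc); apply: (Pl i _).1.
    apply: ord_trans ig => //; exact: lsucc_succ.
  apply: card_le_trans (card_le_lsetU lsl (card_le_lset1 lsl g) (card_le_lbigcup lsl Pgl
    (fun w' _ => card_le_lbigcup lsl gl' (fun a _ => card_le_lset1 lsl (sel w' (e a)))))).
  apply: subset_card_le => w [->|[w' [a [wP ag ->]]]]; first by left.
  by right; exists w' => //; exists a.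
exists (fun g => vset (Q g)); split.
  move=> g gl; apply: card_le_trans (Ql g gl); apply: subset_card_le => w.
  by move=> /(in_vset_card (Ql g gl)).
move=> d dl dt; have od := ord_mem os dl.
have dlim := cf_limit treg od dt.
have QP g w : g ∈ d -> w ∈ vset (Q g) <-> Q g w.
  by move=> gd; apply: (in_vset_card (Ql g (ord_trans os dl gd))).
have [cd|ncd] := pselect (cf d ∈ d); last first.
  have dE : d = t.
    rewrite -dt; apply: vsub_antisym; last exact: cf_sub.
    by apply: ord_ltNle => //; rewrite dt.
  have capE b : b ∈ d -> vcap d b = b.
    move=> bd; apply: vext => z; rewrite in_vcap; split=> [[]//|zb].
    by split=> //; apply: ord_trans zb.
  exists d => [|b bd]; last by exists b => //; rewrite capE //; apply/QP => //; left.
  split; first by split=> // b bd; exists b.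
    by rewrite dE.
  by move=> b bd; rewrite capE //; apply: mem_card_lt => //; rewrite -dE.
have [|x [xd ed xU xP]] := Pd d _ dlim cd; first by apply/in_Scof.
pose a := otp x.
have aE : a = collapse x d by apply: otp_collapse.
have oa : is_ord a by rewrite aE; apply: ord_collapse.
have ox : ords x by move=> y /xd; apply: ord_mem.
have xup b : b ∈ d -> exists2 y, y ∈ x & b ∈ y.
  by rewrite -{1}xU => /in_vunion.
have selc e' : is_cofinal e' a -> is_cofinal (sel x e') d.
  move=> [e'a e'c]; split=> [y /selP[/xd//]|b bd].
  have [y yx by_] := xup b bd.
  have [|u ue yu] := e'c (collapse x y).
    by rewrite aE; apply: collapse_lt => //; apply: xd.
  have : u ∈ a by apply: e'a.
  rewrite aE => /collapseP[y' [y'x y'd uE]]; exists y'; first by apply/selP; rewrite -uE.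
  rewrite uE in yu => z zb; apply: (collapse_le _ _ y'x yu); [exact: ox..|].
  by apply: ord_trans zb => //; apply: ox.
have sele e' : elts (sel x e') #<= elts e'.
  apply: (@card_leI _ _ _ _ (collapse x)) => [y /selP[]//|y y' /selP[yx _] /selP[y'x _]].
  exact: collapse_inj.
(* Ranks of points of [x] above a cofinal subset of [d] are cofinal in [a]; conversely a cofinal
   subset of [a] selects a cofinal subset of [d]. *)
have at_ : cf a = t.
  apply: vsub_antisym.
    have [_ [c [cd' cc] cE] _] := cfP od.
    have /choice[h hP] : forall b, exists y, b ∈ c -> y ∈ x /\ b ∈ y.
      move=> b; have [/cd'/xup[y]|nb] := pselect (b ∈ c); last by exists b.
      by exists y.
    have [_ _ H] := cfP oa.
    have /H H' : is_cofinal (vset (fun z => exists2 b, b ∈ c & z = collapse x (h b))) a.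
      split=> [z /in_vimage[b /hP[hx _] ->]|z].
        by rewrite aE; apply: collapse_lt => //; apply: xd.
      rewrite aE => /collapseP[y [yx yd ->]].
      have [b bc yb] := cc y yd; have [hx bh] := hP b bc.
      exists (collapse x (h b)); first by apply/in_vimage; exists b.
      apply: ord_subset; first by apply: ord_collapse; apply: ox.
      apply: collapse_lt => //; apply: ord_le_lt yb bh; exact: ox.
    move=> z /H' zc; apply: vcard_le_ord ot _ z zc.
    rewrite -dt -(card_le_eqr cE).
    apply: card_le_trans (card_image_le (fun b => collapse x (h b)) (elts c)).
    by apply: subset_card_le => w /in_vimage[b bc ->]; exists b.
  have [_ [c cc cE] _] := cfP oa; have [_ _ /(_ _ (selc c cc))] := cfP od.
  rewrite dt => H; have cac : is_card (cf a) by have [] := cfP oa.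
  rewrite -(vcard_card cac); apply/(vcard_ge _ tc).
  by rewrite -(card_le_eqr cE); apply: card_le_trans (sele c); apply/vcard_ge.
have [eca et eb] := eP a oa at_.
exists (sel x (e a)).
  split; first exact: selc.
    exact: card_le_trans (sele _) et.
  move=> b bd; have [y yx by_] := xup b bd.
  have ya : collapse x y ∈ a by rewrite aE; apply: collapse_lt => //; apply: xd.
  apply: card_le_lt (eb _ ya) => //.
  apply: (@card_leI _ _ _ _ (collapse x)); last first.
    by move=> c c' /in_vcap[/selP[cx _] _] /in_vcap[/selP[c'x _] _]; apply: collapse_inj.
  move=> c /in_vcap[/selP[cx ce] cb]; apply/in_vcap; split=> //.
  by apply: collapse_lt => //; apply: ord_trans cb => //; apply: ox.
move=> b bd; have /in_vbigcup[g gd gP] := xP b bd.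
have [m md [gm am]] := max_in_ord od gd ed.
exists m => //; apply/QP => //; right; exists (vcap x b), a; split.
- apply/in_vbigcup; exists g => //; apply/in_vsucc.
  exact: ord_le (ord_mem od gd) (ord_mem od md) gm.
- by apply/in_vsucc; apply: ord_le (ord_mem od ed) (ord_mem od md) am.
- have ob := ord_mem od bd.
  apply: vext => c; rewrite in_vcap !selP in_vcap; split.
    move=> [[cx ce] cb]; split=> //; rewrite collapse_cap //; exact: ord_subset.
  by move=> [[cx cb]]; rewrite collapse_cap //; apply: ord_subset.
Qed.

Lemma in_subs X k y : y ∈ subs X k <-> y ⊆ X /\ vcard y = k.
Proof. by apply: (@in_vsep (vpow X)) => z [zX _]; apply/in_vpow. Qed.

Lemma in_subs_lt X k y : y ∈ subs_lt X k <-> y ⊆ X /\ vcard y ∈ k.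
Proof. by apply: (@in_vsep (vpow X)) => z [zX _]; apply/in_vpow. Qed.

(** If [d ⊆ N d], weak closure applied to a thin cofinal subset of [d] gives [J] of size [t], still
    thin and cofinal, whose initial segments lie in [N d]. By continuity each of them lies in some
    [N g] with [g] below [d]. *)
Lemma Pr'_approachable : Pr' l t -> approachable l t.
Proof.
move=> [N [Ninc Ncont Nl Nall]].
have /choice[z zP] : forall a, exists e, is_ord a -> cf a = t -> thin_cofinal t e a.
  move=> a; have [[oa at_]|n] := pselect (is_ord a /\ cf a = t); last first.
    by exists a => oa at_; case: n.
  by have [e] := thin_cofinal_ex tc oa at_; exists e.
(* [h b] is a stage at which [b] appears: an ordinal [d] that is not closed under
   [h] lies below some [h b] with [b < d], so the thin set chosen for [d] can
   simply be enumerated at stage [b]. *)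
have /choice[h hP] : forall b, exists i, b ∈ l⁺ -> i ∈ l⁺ /\ b ∈ N i.
  move=> b; have [/Nall/in_vbigcup[i]|nb] := pselect (b ∈ l⁺); last by exists b.
  by exists i.
pose Q g w := w ∈ N g \/ exists a b, [/\ a ∈ vsucc (h g), b ∈ vsucc a & w = vcap (z a) b].
have Ql g : g ∈ l⁺ -> [set w | Q g w] #<= elts l.
  move=> gl; have [hl _] := hP g gl.
  have hsl := lsucc_succ lsl hl.
  have hl' : elts (vsucc (h g)) #<= elts l by apply: mem_card_succ.
  have Ngl : elts (N g) #<= elts l.
    by apply/(vcard_le _ lc); rewrite (Nl g gl).1.
  have al a : a ∈ vsucc (h g) -> elts (vsucc a) #<= elts l.
    by move=> ah; apply: mem_card_succ => //; apply: lsucc_succ => //; apply: ord_trans ah.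
  apply: card_le_trans (card_le_lsetU lsl Ngl (card_le_lbigcup lsl hl'
    (fun a ah => card_le_lbigcup lsl (al a ah)
      (fun b _ => card_le_lset1 lsl (vcap (z a) b))))).
  apply: subset_card_le => w [?|[a [b [ah ba ->]]]]; first by left.
  by right; exists a => //; exists b.
exists (fun g => vset (Q g)); split.
  move=> g gl; apply: card_le_trans (Ql g gl); apply: subset_card_le => w.
  by move=> /(in_vset_card (Ql g gl)).
move=> d dl dt; have od := ord_mem os dl.
have zthin := zP d od dt.
have QP g w : g ∈ d -> w ∈ vset (Q g) <-> Q g w.
  by move=> gd; apply: (in_vset_card (Ql g (ord_trans os dl gd))).
have [[b bd hb]|nb] := pselect (exists2 b, b ∈ d & ~ h b ∈ d).
  have [hl _] := hP b (ord_trans os dl bd).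
  exists (z d) => // b' b'd; exists b => //; apply/QP => //; right.
  exists d, b'; split=> //; last by apply: sub_vsucc.
  apply/in_vsucc; apply: ord_le => //; first exact: ord_mem os hl.
  by apply: ord_ltNle => //; apply: ord_mem os hl.
have dN : d ⊆ N d.
  move=> b bd; have [hl bN] := hP b (ord_trans os dl bd).
  by apply: Ninc bN => //; apply: contrapT => hb; apply: nb; exists b.
have [zd _ _] := zthin; have [zd' _] := zd.
have [||J] := (Nl d dl).2 (z d).
- apply/in_subs; split=> [b /zd'/dN//|]; apply/vcard_eq => //.
  exact: thin_cofinal_card dt zthin.
- by move=> b /zd'; apply: ord_mem.
move=> /in_subs[Jz Jt] JN.
have Jthin : thin_cofinal t J d.
  by apply: thin_cofinal_sub zthin Jz _ => //; apply/vcard_eq.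
exists J => // b bd.
have /JN : vcap J b ∈ subs_lt J t.
  by apply/in_subs_lt; split=> [y /in_vcap[]//|]; case: Jthin => _ _; apply.
rewrite Ncont //; last exact: cf_limit dt.
by move=> /in_vbigcup[g gd gN]; exists g => //; apply/QP => //; left.
Qed.

(** By regularity of [t = s⁺], one of the [s] pieces of a thin cofinal set has size [t], hence is
    itself thin and cofinal. *)
Lemma Sp_approachable s : is_card s -> t = s⁺ -> Sp s l -> approachable l t.
Proof.
move=> sca tE [P [Pl Pd]].
have [_ st _] := card_succP sca; rewrite -tE in st.
pose Q g w := exists v b, [/\ v ∈ vbigcup (vsucc g) P, b ∈ vsucc g & w = vcap v b].
have Ql g : g ∈ l⁺ -> [set w | Q g w] #<= elts l.
  move=> gl; have gl' : elts (vsucc g) #<= elts l.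
    by apply: succ_le => //; apply: mem_card_succ.
  have Pgl : elts (vbigcup (vsucc g) P) #<= elts l.
    apply: vbigcup_le => // i ig.
    apply/(vcard_le _ lc); apply: (Pl i _).2.
    apply: ord_trans ig => //; exact: lsucc_succ.
  apply: card_le_trans (card_le_lbigcup lsl Pgl
    (fun w' _ => card_le_lbigcup lsl gl' (fun a _ => card_le_lset1 lsl (vcap w' a)))).
  by apply: subset_card_le => w [v [b [vP bg ->]]]; exists v => //; exists b.
exists (fun g => vset (Q g)); split.
  move=> g gl; apply: card_le_trans (Ql g gl); apply: subset_card_le => w.
  by move=> /(in_vset_card (Ql g gl)).
move=> d dl dt; have od := ord_mem os dl.
have QP g w : g ∈ d -> w ∈ vset (Q g) <-> Q g w.
  by move=> gd; apply: (in_vset_card (Ql g (ord_trans os dl gd))).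
have [z zthin] := thin_cofinal_ex tc od dt.
have zt : vcard z = t by apply/vcard_eq => //; apply: thin_cofinal_card dt zthin.
have [zd _ _] := zthin; have [zd' _] := zd.
have [||y [zE yP]] := Pd d dl _ z zd; [by rewrite dt|by rewrite zt|].
have [n ns ynt] : exists2 n, n ∈ s & elts t #<= elts (y n).
  apply: contrapT => nn; apply: (@vmem_irrefl t); rewrite -{1}zt zE.
  apply: regular_bigcup => //; first by rewrite vcard_card.
  by move=> n ns; apply/(vcard_lt _ tc) => H; apply: nn; exists n.
have ynz : y n ⊆ z by rewrite zE => w wy; apply/in_vbigcup; exists n.
have yt : elts (y n) #= elts t.
  rewrite card_eq_le ynt andbT; case: zthin => _ zt' _; apply: card_le_trans zt'.
  exact: elts_sub.
have Jthin := thin_cofinal_sub tc od zthin ynz yt.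
exists (y n) => // b bd.
(* [Sp] enumerates subsets of size exactly [s], while the segment below [b] may be smaller. A longer
   segment, containing a subset [y0] of size [s], has size [s], and is cut back at [b]. *)
have [y0 y0y y0s] : exists2 y0, y0 ⊆ y n & elts y0 #= elts s.
  have /card_leE[f [fin finj]] : elts s #<= elts (y n).
    by apply: card_le_trans ynt; apply: elts_sub; apply: ord_subset.
  exists (vset (fun z => exists2 i, i ∈ s & z = f i)).
    by move=> w /in_vimage[i si ->]; apply: fin.
  have <- : f @` elts s = elts (vset (fun z => exists2 i, i ∈ s & z = f i)).
    apply/seteqP; split=> w.
      by move=> [i si <-]; apply/in_vimage; exists i.
    by move=> /in_vimage[i si ->]; exists i.
  by apply: inj_card_eq => i j /set_mem si /set_mem sj; apply: finj.
have [||b1 b1d yb1] := @bounded_cf d y0 od.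
- by rewrite dt (vcard_eq _ sca).2.
- by move=> w /y0y/ynz/zd'.
have [b0 b0d [bb0 b1b0]] := max_in_ord od bd b1d.
have Jb0 : vcap (y n) b0 ∈ subs (y n) s.
  apply/in_subs; split=> [w /in_vcap[]//|]; apply/vcard_eq => //.
  rewrite card_eq_le; apply/andP; split.
    by apply/(lt_card_succ _ sca); rewrite -tE; case: Jthin => _ _; apply.
  rewrite -(card_le_eql y0s); apply: elts_sub => w wy; apply/in_vcap; split; first exact: y0y.
  exact/b1b0/yb1.
have /in_vbigcup[g0 g0d gP] := yP n ns _ Jb0.
have [m md [gm bm]] := max_in_ord od g0d bd.
exists m => //; apply/QP => //; exists (vcap (y n) b0), b; split.
- apply/in_vbigcup; exists g0 => //; apply/in_vsucc.
  exact: ord_le (ord_mem od g0d) (ord_mem od md) gm.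
- by apply/in_vsucc; apply: ord_le (ord_mem od bd) (ord_mem od md) bm.
- apply: vext => w; rewrite !in_vcap; split=> [[wy wb]|[[wy _] wb]//].
  by split=> //; split=> //; apply: bb0.
Qed.

End Approach.

(** * Hereditary cardinality and Skolem hulls *)

Lemma trans_superset x : exists2 s, is_trans s & x ⊆ s.
Proof.
have sP := in_vset_Union (fun n => iter n vunion x).
exists (vset (fun z => exists n, z ∈ iter n vunion x)).
  move=> y /sP[n yn] z zy; apply/sP; exists n.+1; apply/in_vunion; by exists y.
by move=> z zx; apply/sP; exists 0%N.
Qed.

Lemma in_trcl x y : y ∈ trcl x <-> forall t, is_trans t -> x ⊆ t -> y ∈ t.
Proof. by have [s ts xs] := trans_superset x; apply: (@in_vsep s) => z; apply. Qed.

Lemma sub_trcl x : x ⊆ trcl x.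
Proof. by move=> z zx; apply/in_trcl => t _; apply. Qed.

Lemma trans_trcl x : is_trans (trcl x).
Proof.
move=> y /in_trcl yx z zy; apply/in_trcl => t tt xt.
exact: tt (yx t tt xt) _ zy.
Qed.

Lemma trcl_mem x y : y ∈ x -> trcl y ⊆ trcl x.
Proof.
move=> yx z /in_trcl zy; apply/in_trcl => t tt xt; apply: zy => //.
exact: tt (xt _ yx).
Qed.

(** Trees branching along the members of a fixed set code all hereditarily
    small sets, so that these form a set. *)
Inductive wtree (I : Type) (B : I -> Type) := wsup (i : I) of (B i -> wtree B).

Fixpoint weval (I : Type) (B : I -> Type) (w : wtree B) : V :=
  let: wsup i f := w in \pi_V (node (fun b => repr (weval (f b)))).

Definition hsmall (T x : V) : Prop :=
  vcard x ∈ T /\ forall y, y ∈ trcl x -> vcard y ∈ T.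

Lemma hsmall_mem T x y : hsmall T x -> y ∈ x -> hsmall T y.
Proof.
move=> [xT cT] yx; split; first by apply: cT; apply: sub_trcl.
by move=> z /(trcl_mem yx); apply: cT.
Qed.

(** A code for [x] branches along [vcard x], a member of [T], with codes for the members of [x]
    given by induction. *)
Lemma in_Hset_hsmall T x : x ∈ Hset T <-> hsmall T x.
Proof.
have [I [g TE]] := vP T.
apply: (@in_vset (wtree (fun i => tbranch (g i))) (@weval _ _)) => {x}.
elim/vmem_ind => x IH hx.
have /vmem_pi[i iE] : vcard x ∈ \pi_V (node g) by rewrite -TE; case: hx.
have [h hP] : exists h : tbranch (g i) -> V, forall z, z ∈ vcard x <-> exists b, z = h b.
  rewrite iE; case: (g i) => A f; exists (fun a => \pi_V (f a)) => z; exact: vmem_pi.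
have [f [fin finj fsurj]] : exists f : V -> V, [/\ forall y, y ∈ vcard x -> f y ∈ x,
    forall y z, y ∈ vcard x -> z ∈ vcard x -> f y = f z -> y = z &
    forall z, z ∈ x -> exists2 y, y ∈ vcard x & f y = z].
  by apply: card_eqE; rewrite card_eq_sym vcard_eqv.
have /choice[w wP] : forall b, exists w : wtree (fun i => tbranch (g i)), f (h b) = weval w.
  move=> b; have fx : f (h b) ∈ x by apply: fin; apply/hP; exists b.
  by apply: IH => //; apply: hsmall_mem hx fx.
exists (@wsup I (fun i => tbranch (g i)) i w); apply: vext => z /=; rewrite vmem_pi; split.
  move=> /fsurj[y /hP[b ->] <-]; exists b; by rewrite reprK.
move=> [b ->]; rewrite reprK -wP; apply: fin; apply/hP; by exists b.
Qed.

Lemma in_Hset T x : x ∈ Hset T <-> vcard x ∈ T /\ forall y, y ∈ x -> y ∈ Hset T.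
Proof.
rewrite in_Hset_hsmall; split=> [hx|[xT xH]].
  by split=> [|y yx]; [case: hx|apply/in_Hset_hsmall; apply: hsmall_mem hx yx].
have {}xH y : y ∈ x -> hsmall T y by move=> /xH/in_Hset_hsmall.
split=> // z /in_trcl zx.
have sP v : v ∈ vset (fun z => z ∈ x \/ exists2 y, y ∈ x & z ∈ trcl y) <->
    v ∈ x \/ exists2 y, y ∈ x & v ∈ trcl y.
  by apply: (@in_vsep (trcl x)) => u [/sub_trcl//|[y yx]]; apply: trcl_mem.
have : z ∈ vset (fun z => z ∈ x \/ exists2 y, y ∈ x & z ∈ trcl y).
  apply: zx => [v /sP[vx|[y yx vy]] w wv|v vx]; apply/sP; [right|right|by left].
    by exists v => //; apply: sub_trcl.
  by exists y => //; apply: trans_trcl wv.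
move/sP.
by move=> [/xH[]//|[y /xH[_ yT] /yT]].
Qed.

Lemma ord_Hset T a : is_card T -> a ∈ T -> a ∈ Hset T.
Proof.
move=> Tc; elim/vmem_ind: a => a IH aT; apply/in_Hset; split; first exact: mem_card_lt.
by move=> b ba; apply: IH => //; apply: ord_trans (ord_card Tc) aT ba.
Qed.

(** * Satisfaction, Skolem functions and elementary submodels *)

Fixpoint fbound (p : formula) : nat :=
  match p with
  | FMem i j | FEq i j => (maxn i j).+1
  | FNot q | FEx _ q => fbound q
  | FAnd q r => maxn (fbound q) (fbound r)
  end.

Lemma sat_ext M p e e' : (forall k, (k < fbound p)%N -> e k = e' k) ->
  sat M e p <-> sat M e' p.
Proof.
elim: p e e' => [i j|i j|q IH|q IHq r IHr|n q IH] e e' /= ee'.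
- by rewrite !ee' // ltnS ?leq_maxl ?leq_maxr.
- by rewrite !ee' // ltnS ?leq_maxl ?leq_maxr.
- by rewrite (IH e e').
- by rewrite (IHq e e') ?(IHr e e') // => k kp; apply: ee'; rewrite leq_max kp ?orbT.
- split=> -[x xM sx]; exists x => //; move: sx; apply IH => k kq; rewrite /update.
    by case: eqP => // _; rewrite ee'.
  by case: eqP => // _; rewrite ee'.
Qed.

Fixpoint fcode (p : formula) : GenTree.tree nat :=
  match p with
  | FMem i j => GenTree.Node 0 [:: GenTree.Leaf i; GenTree.Leaf j]
  | FEq i j => GenTree.Node 1 [:: GenTree.Leaf i; GenTree.Leaf j]
  | FNot q => GenTree.Node 2 [:: fcode q]
  | FAnd q r => GenTree.Node 3 [:: fcode q; fcode r]
  | FEx n q => GenTree.Node 4 [:: GenTree.Leaf n; fcode q]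
  end.

Lemma fcode_inj : injective fcode.
Proof.
elim=> [i j|i j|q IH|q IHq r IHr|n q IH] [i' j'|i' j'|q'|q' r'|n' q'] //=.
- by move=> [-> ->].
- by move=> [-> ->].
- by move=> [/IH ->].
- by move=> [/IHq -> /IHr ->].
- by move=> [-> /IH ->].
Qed.

(** A Skolem function. A formula sees finitely many variables, so a finite list padded with [vempty]
    serves as assignment; the value is [vempty] if there is no witness. *)
Definition witness (H : V) (p : formula) (n : nat) (s : seq V) : V :=
  xget vempty [set x | x ∈ H /\ sat H (update (nth vempty s) n x) p].

Definition skolem_closed (H M : V) : Prop :=
  forall p n s, (forall x, x \in s -> x ∈ M) -> witness H p n s ∈ M.

(** The Tarski-Vaught test, with assignments truncated at [fbound q] to become parameter lists. *)
Lemma skolem_elem H M : M ⊆ H -> skolem_closed H M -> elem_submodel M H.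
Proof.
move=> MH Msk; split=> //.
  move=> M0; have := Msk (FEq 0 0) 0%N [::]; rewrite M0 => W.
  by apply: (in_vempty (W _)).
elim=> [i j|i j|q IH|q IHq r IHr|n q IH] e eM //=.
- by rewrite IH.
- by rewrite IHq ?IHr.
- have upM x : x ∈ M -> forall k, update e n x k ∈ M.
    by move=> xM k; rewrite /update; case: eqP.
  split=> -[x xM sx]; first by exists x; [apply: MH|apply/IH => //; apply: upM].
  pose s := mkseq e (fbound q).
  have sE y k : (k < fbound q)%N -> update e n y k = update (nth vempty s) n y k.
    by move=> kq; rewrite /update; case: eqP => // _; rewrite nth_mkseq.
  have [wH ws] : (witness H q n s ∈ H) /\
      sat H (update (nth vempty s) n (witness H q n s)) q.
    apply: (@xgetPex _ _ [set x | x ∈ H /\ sat H (update (nth vempty s) n x) q]).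
    by exists x; split=> //; rewrite -(sat_ext _ (sE x)).
  have wM : witness H q n s ∈ M by apply: Msk => y /mapP[k _ ->].
  exists (witness H q n s) => //; apply/IH; first exact: upM.
  by rewrite (sat_ext _ (sE _)).
Qed.

Lemma seq_directed (I : Type) (F : I -> V) (s : seq V) (i0 : I) :
  (forall i j, exists k, F i ⊆ F k /\ F j ⊆ F k) ->
  (forall x, x \in s -> exists i, x ∈ F i) ->
  exists i, forall x, x \in s -> x ∈ F i.
Proof.
move=> dir; elim: s => [|x s IH] sF; first by exists i0.
have [i xi] := sF x (mem_head x s).
have [y ys|j sj] := IH; first by apply: sF; rewrite inE ys orbT.
have [k [ik jk]] := dir i j; exists k => y; rewrite inE => /orP[/eqP->|/sj/jk//].
exact: ik.
Qed.

Lemma finite_directed (I : Type) (F : I -> V) (y : V) (i0 : I) :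
  (forall i j, exists k, F i ⊆ F k /\ F j ⊆ F k) ->
  finite_set (elts y) -> (forall x, x ∈ y -> exists i, x ∈ F i) ->
  exists i, y ⊆ F i.
Proof.
move=> dir /finite_seqP[s sE] yF.
have sy x : x ∈ y <-> x \in s.
  by split=> [xy|xs]; [have : elts y x by []; rewrite sE|change (elts y x); rewrite sE].
have [x /sy/yF//|i iP] := @seq_directed I F s i0 dir.
by exists i => x /sy/iP.
Qed.

(** * Colourings with small homogeneous sets *)

Definition colorable (t I : V) (Q : V -> Prop) : Prop :=
  exists R (c : V -> V), [/\ vcard R ∈ t, forall a, a ∈ I -> c a ∈ R &
    forall r y, r ∈ R -> y ⊆ I -> vcard y ∈ t -> (forall a, a ∈ y -> c a = r) -> Q y].

(** By regularity one of fewer than [t] colour classes has size [t]; it serves as [J]. *)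
Lemma colorable_homogeneous t I Q : is_regular t -> colorable t I Q -> vcard I = t ->
  exists2 J, J ∈ subs I t & forall y, y ∈ subs_lt J t -> Q y.
Proof.
move=> treg [R [c [Rt cR cQ]]] It; have [[tc _] _] := treg.
pose A r := vset (fun a => a ∈ I /\ c a = r).
have AP r a : a ∈ A r <-> a ∈ I /\ c a = r by apply: (@in_vsep I) => z [].
have [r rR tA] : exists2 r, r ∈ R & elts t #<= elts (A r).
  apply: contrapT => nr; apply: (@vmem_irrefl t); rewrite -{1}It.
  have -> : I = vbigcup R A.
    apply: vext => a; rewrite in_vbigcup; split=> [aI|[r _ /AP[]//]].
    by exists (c a); [apply: cR|apply/AP].
  by apply: regular_bigcup => // r rR; apply/(vcard_lt _ tc) => H; apply: nr; exists r.
exists (A r) => [|y /in_subs_lt[yA yt]].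
  apply/in_subs; split=> [a /AP[]//|]; apply/vcard_eq => //.
  rewrite card_eq_le tA andbT -(card_le_eqr (((vcard_eq I tc).1 It))).
  by apply: elts_sub => a /AP[].
by apply: (cQ r) => // a /yA/AP[].
Qed.

(** * Decompositions, closures under small subsets, and their colourings *)

Section Colorings.

Variables (l t : V) (lsl : is_strong_limit l) (treg : is_regular t) (tl : t ∈ l).

Let lc : is_card l. Proof. by case: lsl => -[]. Qed.
Let ol : is_ord l. Proof. exact: ord_card lc. Qed.
Let sc : is_card l⁺. Proof. by case: (card_succP lc). Qed.
Let os : is_ord l⁺. Proof. exact: ord_card sc. Qed.
Let tc : is_card t. Proof. by case: treg => -[]. Qed.
Let ot : is_ord t. Proof. exact: ord_card tc. Qed.
Let tinf : infinite_set (elts t). Proof. by case: treg => -[]. Qed.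

Lemma lt_le x : vcard x ∈ l -> elts x #<= elts l.
Proof. by move=> xl; apply/vcard_le => //; apply: ord_subset. Qed.

(** The piece [dec Y n] consists of the values at indices below [n] of a fixed enumeration of [Y]
    along [l]. *)
Lemma decomposition_ex : exists dec : V -> V -> V, forall Y, elts Y #<= elts l ->
  [/\ forall n, dec Y n ⊆ Y, forall n, elts (dec Y n) #<= elts n,
      forall m n, m ⊆ n -> dec Y m ⊆ dec Y n &
      forall y, y ∈ Y -> exists2 n, n ∈ l & y ∈ dec Y n].
Proof.
have /choice[g gP] : forall Y, exists g : V -> V, elts Y #<= elts l ->
    forall y, y ∈ Y -> exists2 i, i ∈ l & g i = y.
  move=> Y; have [/card_leS[g]|n] := pselect (elts Y #<= elts l); last by exists id.
  by exists g.
pose dec Y n := vset (fun z => z ∈ Y /\ exists2 i, i ∈ n & z = g Y i).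
have decP Y n z : z ∈ dec Y n <-> z ∈ Y /\ exists2 i, i ∈ n & z = g Y i.
  by apply: (@in_vsep Y) => y [].
exists dec => Y Yl; split.
- by move=> n z /decP[].
- move=> n; apply: card_le_trans (card_image_le (g Y) (elts n)).
  by apply: subset_card_le => z /decP[_ [i iN ->]]; exists i.
- by move=> m n mn z /decP[zY [i im zE]]; apply/decP; split=> //; exists i => //; apply: mn.
(* The successor is taken because the piece at [n] uses indices strictly below [n]. *)
- move=> y yY; have [i il iE] := gP Y Yl y yY; exists (vsucc i); first exact: succ_lt.
  by apply/decP; split=> //; exists i => //; apply: vsucc_refl.
Qed.

Definition dec : V -> V -> V := sval (cid decomposition_ex).

Lemma decP Y : elts Y #<= elts l ->
  [/\ forall n, dec Y n ⊆ Y, forall n, elts (dec Y n) #<= elts n,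
      forall m n, m ⊆ n -> dec Y m ⊆ dec Y n &
      forall y, y ∈ Y -> exists2 n, n ∈ l & y ∈ dec Y n].
Proof. by rewrite /dec; case: cid => d /=; apply. Qed.

(** There may be more than [l] subsets of [Y] of size below [t]. Those inside a single piece number
    at most [l], as [l] is a strong limit. *)
Definition small_closure (Y : V) : V :=
  vset (fun y => vcard y ∈ t /\ exists2 n, n ∈ l & y ⊆ dec Y n).

Lemma in_small_closure Y y : elts Y #<= elts l ->
  (y ∈ small_closure Y <-> vcard y ∈ t /\ exists2 n, n ∈ l & y ⊆ dec Y n).
Proof.
move=> /decP[dY _ _ _]; apply: (@in_vsep (vpow Y)) => z [_ [n _ zd]].
by apply/in_vpow => w /zd/dY.
Qed.

Lemma small_closure_le Y : elts Y #<= elts l -> elts (small_closure Y) #<= elts l.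
Proof.
move=> Yl; have [_ dl _ _] := decP Yl.
apply: card_le_trans
  (@card_le_lbigcup _ lsl _ _ (elts l) (fun n => elts (vpow (dec Y n))) _ _).
- apply: subset_card_le => y /(in_small_closure _ Yl)[_ [n nl yd]].
  by exists n => //; apply/in_vpow.
- by [].
- move=> n nl; apply: lt_le; apply: vpow_lt => //.
  by apply: card_le_lt (dl n) _ _ => //; apply: mem_card_lt.
Qed.

Lemma small_closure_sub Y y : elts Y #<= elts l -> y ∈ small_closure Y -> y ⊆ Y /\ vcard y ∈ t.
Proof.
move=> Yl /(in_small_closure _ Yl)[yt [n _ yd]]; split=> // z /yd.
by have [dY _ _ _] := decP Yl; apply: dY.
Qed.

(** Since [t] is at most [cf l], the indices of pieces holding the members of [y] are bounded in
    [l]. *)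
Lemma small_closure_all Y y : elts Y #<= elts l -> ~ cf l ∈ t -> y ⊆ Y -> vcard y ∈ t ->
  y ∈ small_closure Y.
Proof.
move=> Yl tcf yY yt; apply/in_small_closure => //; split=> //.
have [_ _ dmono dall] := decP Yl.
have [cc _ _] := cfP ol.
have ycf : vcard y ∈ cf l by apply: (ord_ltNle (ord_card cc) ot tcf).
have /choice[nu nuP] : forall a, exists n, a ∈ y -> n ∈ l /\ a ∈ dec Y n.
  move=> a; have [/yY/dall[n]|na] := pselect (a ∈ y); last by exists a.
  by exists n.
have [|b bl bP] := @bounded_fun l y nu ol ycf; first by move=> i /nuP[].
exists b => // a ay; have [nl an] := nuP a ay; apply: dmono an.
by apply: ord_subset (bP a ay); apply: ord_mem bl.
Qed.

Lemma single_lt x : vcard (vpair x x) ∈ t.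
Proof.
apply/vcard_lt => // H; apply: (@infinite_set1F x t) => //.
by apply: card_le_trans H _; apply: subset_card_le => y /in_vpair[] ->.
Qed.

(** The pieces are directed, so a finite set fits into one of them. This settles countable [t] in
    the hull construction. *)
Lemma small_closure_finite Y y : elts Y #<= elts l -> finite_set (elts y) -> y ⊆ Y ->
  y ∈ small_closure Y.
Proof.
move=> Yl yf yY; apply/in_small_closure => //; split.
  apply/vcard_lt => // ty; apply: tinf; exact: card_le_finite ty yf.
have [dY dl dmono dall] := decP Yl.
have [x0 x0t] : exists x, x ∈ t.
  apply: contrapT => n; apply: tinf; have -> : elts t = set0; last exact: finite_set0.
  by apply/seteqP; split=> // x xt; case: n; exists x.
have x0l : x0 ∈ l by apply: ord_trans tl x0t.
pose F (n : {n : V | n ∈ l}) := dec Y (sval n).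
have [||[n nl] nP] := @finite_directed _ F y (exist _ x0 x0l) _ yf.
- move=> [i il] [j jl]; have [m ml [im jm]] := max_in_ord ol il jl.
  by exists (exist _ m ml); split; apply: dmono.
- by move=> a /yY/dall[n nl an]; exists (exist _ n nl).
- by exists n.
Qed.

(** One colour suffices if [t] is at most [cf l]. Otherwise the colour of [a] is the index of a
    piece containing it, taken in a cofinal [R] of size [cf l]. *)
Lemma small_closure_color Y I : elts Y #<= elts l -> I ⊆ Y ->
  colorable t I (fun y => y ∈ small_closure Y).
Proof.
move=> Yl IY; have [cft|ncft] := pselect (cf l ∈ t); last first.
  exists (vpair vempty vempty), (fun=> vempty); split.
  - exact: single_lt.
  - by move=> a _; apply/in_vpair; left.
  - by move=> r y _ yI yt _; apply: small_closure_all => // a /yI/IY.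
have [cc [R [Rl Rcof] RE] _] := cfP ol.
have [_ _ dmono dall] := decP Yl.
have /choice[c cP] : forall a, exists n, a ∈ I -> n ∈ R /\ a ∈ dec Y n.
  move=> a; have [/IY/dall[n nl an]|na] := pselect (a ∈ I); last by exists a.
  by have [m mR nm] := Rcof n nl; exists m => _; split=> //; apply: dmono an.
exists R, c; split.
- by rewrite (vcard_eq _ cc).2.
- by move=> a /cP[].
- move=> r y rR yI yt yc; apply/in_small_closure => //; split=> //; exists r; first exact: Rl.
  by move=> a ay; rewrite -(yc a ay); apply: (cP a (yI _ ay)).2.
Qed.

Variables (P : V -> V) (Pl : forall g, g ∈ l⁺ -> elts (P g) #<= elts l).
Hypothesis (Pd : forall d, d ∈ l⁺ -> cf d = t -> exists2 z, thin_cofinal t z d &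
      forall b, b ∈ d -> exists2 g, g ∈ d & vcap z b ∈ P g).

Definition layer (X : V -> V) (w n : V) : V := vbigcup w (fun i => dec (X i) n).

Definition guided (X : V -> V) (g y : V) : Prop :=
  vcard y ∈ t /\ exists w n, [/\ w ∈ vbigcup (vsucc g) P, w ⊆ g, vcard w ∈ t, n ∈ l &
    y ⊆ layer X w n].

Definition approach_closure (X : V -> V) (g : V) : V :=
  vset (fun y => guided X g y \/ y ∈ small_closure (X g)).

(** There are at most [l] choices of [w] and [n]. Each layer is a union of fewer than [t] pieces of
    size at most [n], so it has fewer than [l] subsets. *)
Lemma guided_le X g : g ∈ l⁺ -> (forall i, i ∈ vsucc g -> elts (X i) #<= elts l) ->
  [set y | guided X g y \/ y ∈ small_closure (X g)] #<= elts l.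
Proof.
move=> gl Xl.
apply: card_le_trans (@card_le_lsetU _ lsl _ [set y | guided X g y]
  (elts (small_closure (X g))) _ _) => //.
  have Pgl : elts (vbigcup (vsucc g) P) #<= elts l.
    apply: vbigcup_le => // [|i ig]; first by apply: succ_le => //; apply: mem_card_succ.
    by apply: Pl; apply: ord_trans ig => //; apply: lsucc_succ.
  pose W := [set w | [/\ w ∈ vbigcup (vsucc g) P, w ⊆ g & vcard w ∈ t]].
  have Wl : W #<= elts l by apply: card_le_trans Pgl; apply: subset_card_le => w [].
  have layl w n : W w -> elts l n -> elts (vpow (layer X w n)) #<= elts l.
    move=> [_ wg wt] nl; apply: lt_le; apply: vpow_lt => //.
    apply: (@vbigcup_lt _ lsl _ _ n) => //; first exact: ord_trans tl wt.
    move=> i /wg ig; have [|_ H _ _] := @decP (X i); last exact: H.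
    by apply: Xl; apply: sub_vsucc.
  apply: card_le_trans (card_le_lbigcup lsl Wl
    (fun w wW => card_le_lbigcup lsl (card_lexx (elts l)) (fun n nl => layl w n wW nl))).
  apply: subset_card_le => y [yt [w [n [wP wg wt nl yw]]]].
  by exists w => //; exists n => //; apply/in_vpow.
by apply: small_closure_le; apply: Xl; apply: vsucc_refl.
Qed.

Lemma in_approach_closure X g y : g ∈ l⁺ -> (forall i, i ∈ vsucc g -> elts (X i) #<= elts l) ->
  (y ∈ approach_closure X g <-> guided X g y \/ y ∈ small_closure (X g)).
Proof. by move=> gl Xl; apply: (in_vset_card (guided_le gl Xl)). Qed.

Lemma approach_closure_le X g : g ∈ l⁺ -> (forall i, i ∈ vsucc g -> elts (X i) #<= elts l) ->
  elts (approach_closure X g) #<= elts l.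
Proof.
move=> gl Xl; apply: card_le_trans (guided_le gl Xl); apply: subset_card_le => y.
by move=> /(in_approach_closure _ gl Xl).
Qed.

Lemma approach_closure_sub X g y : g ∈ l⁺ ->
  (forall i, i ∈ vsucc g -> elts (X i) #<= elts l) ->
  y ∈ approach_closure X g -> y ⊆ vbigcup (vsucc g) X /\ vcard y ∈ t.
Proof.
move=> gl Xl.
move=> /(in_approach_closure _ gl Xl)[[yt [w [n [_ wg _ _ yw]]]]|/small_closure_sub[|yX yt]].
- split=> // z /yw/in_vbigcup[i iw zd]; apply/in_vbigcup; exists i.
    by apply: sub_vsucc; apply: wg.
  have [|H _ _ _] := @decP (X i); last exact: H zd.
  by apply: Xl; apply: sub_vsucc; apply: wg.
- by apply: Xl; apply: vsucc_refl.
- by split=> // z /yX zX; apply/in_vbigcup; exists g => //; apply: vsucc_refl.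
Qed.

(** The closure at [g] reads [X] only up to [g], which allows its use in a recursion. *)
Lemma approach_closure_ext X X' g : (forall i, i ∈ vsucc g -> X i = X' i) ->
  approach_closure X g = approach_closure X' g.
Proof.
move=> XX'; rewrite /approach_closure (XX' g (vsucc_refl g)); congr vset.
have E w n : w ⊆ g -> layer X w n = layer X' w n.
  move=> wg; apply: vext => z; rewrite !in_vbigcup; split=> -[i iw zi]; exists i => //.
    by rewrite -XX' //; apply: sub_vsucc; apply: wg.
  by rewrite XX' //; apply: sub_vsucc; apply: wg.
apply/funext => y; apply/propext; split=> -[[yt [w [n [wP wg wt nl yw]]]]|?]; by
  [right|left; split=> //; exists w, n; split=> //; move: yw; rewrite E].
Qed.

(** If [t] is at most [cf l], a small set lies in one earlier stage and in its small closure.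
    Otherwise each [a] gets a stage in the approaching set [z] and a piece index in [R], and only
    the index is its colour. The stages of a small monochromatic set are bounded below [d], so they
    lie in an initial segment of [z], which is enumerated before [d]. *)
Lemma approach_closure_color X d I :
  (forall i, i ∈ l⁺ -> elts (X i) #<= elts l) ->
  (forall i j, i ⊆ j -> i ∈ l⁺ -> j ∈ l⁺ -> X i ⊆ X j) ->
  d ∈ l⁺ -> cf d = t -> I ⊆ vbigcup d X ->
  colorable t I (fun y => exists2 g, g ∈ d & y ∈ approach_closure X g).
Proof.
move=> Xl Xmono dl dt IX; have od := ord_mem os dl.
have inC g y : g ∈ d -> (guided X g y \/ y ∈ small_closure (X g)) -> y ∈ approach_closure X g.
  move=> gd; have gl : g ∈ l⁺ by apply: ord_trans gd.
  apply in_approach_closure => // i ig; apply: Xl; apply: ord_trans ig => //.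
  exact: lsucc_succ.
have [cft|ncft] := pselect (cf l ∈ t); last first.
  exists (vpair vempty vempty), (fun=> vempty); split.
  - exact: single_lt.
  - by move=> a _; apply/in_vpair; left.
  move=> r y _ yI yt _.
  have /choice[h hP] : forall a, exists i, a ∈ y -> i ∈ d /\ a ∈ X i.
    move=> a; have [/yI/IX/in_vbigcup[i]|na] := pselect (a ∈ y); last by exists a.
    by exists i.
  have [||b bd bP] := @bounded_fun d y h od; first by rewrite dt.
    by move=> i /hP[].
  have bl : b ∈ l⁺ by apply: ord_trans bd.
  exists b => //; apply: inC => //; right; apply: small_closure_all => //; first exact: Xl.
  move=> a ay; have [hd aX] := hP a ay; apply: Xmono aX => //; last exact: ord_trans hd.
  by apply: ord_subset (bP a ay); apply: ord_mem bl.
have [cc [R [Rl Rcof] RE] _] := cfP ol.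
have [z zthin zP] := Pd dl dt.
have [[zd zc] _ zb] := zthin.
have /choice[c cP] : forall a, exists p : V * V, a ∈ I ->
    [/\ p.1 ∈ z, p.2 ∈ R & a ∈ dec (X p.1) p.2].
  move=> a; have [/IX/in_vbigcup[i iD ai]|na] := pselect (a ∈ I); last by exists (a, a).
  have [j jz ij] := zc i iD.
  have jl : j ∈ l⁺ by apply: ord_trans (zd _ jz).
  have [_ _ dmono dall] := decP (Xl j jl).
  have [n nl an] := dall a (Xmono i j ij (ord_trans os dl iD) jl a ai).
  by have [m mR nm] := Rcof n nl; exists (j, m) => _; split=> //; apply: dmono an.
exists R, (fun a => (c a).2); split.
- by rewrite (vcard_eq _ cc).2.
- by move=> a /cP[].
move=> r y rR yI yt yc.
have [||b bd bP] := @bounded_fun d y (fun a => (c a).1) od; first by rewrite dt.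
  by move=> a /yI/cP[/zd].
have [g gd gP] := zP b bd.
(* A guiding set must be enumerated by stage [m] and also be a subset of [m]. *)
have [m md [gm bm]] := max_in_ord od gd bd.
exists m => //; apply: inC => //; left; split=> //; exists (vcap z b), r; split.
- apply/in_vbigcup; exists g => //; apply/in_vsucc.
  exact: ord_le (ord_mem od gd) (ord_mem od md) gm.
- by move=> w /in_vcap[_ /bm].
- exact: zb.
- exact: Rl.
- move=> a ay; have [c1 c2 ac] := cP a (yI a ay).
  apply/in_vbigcup; exists (c a).1; last by rewrite -(yc a ay).
  by apply/in_vcap; split=> //; apply: bP.
Qed.

(** Use the closure of the chain [X i = i]. A cofinal [x] is coloured with fewer than [s⁺], hence at
    most [s], colours, and an injection of the colours into [s] indexes the colour classes as the
    pieces of [x]. *)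
Lemma sequence_Sp s : is_card s -> t = s⁺ -> Sp s l.
Proof.
move=> sca tE; have [_ st _] := card_succP sca; rewrite -tE in st.
pose C := approach_closure id.
have idl i : i ∈ l⁺ -> elts (id i) #<= elts l by move=> il; apply: mem_card_succ.
have idl' g i : g ∈ l⁺ -> i ∈ vsucc g -> elts (id i) #<= elts l.
  by move=> gl ig; apply: idl; apply: ord_trans ig => //; apply: lsucc_succ.
pose S g := vset (fun y => y ∈ subs g s /\ exists2 i, i ∈ vsucc g & y ∈ C i).
have SP g y : y ∈ S g <-> y ∈ subs g s /\ exists2 i, i ∈ vsucc g & y ∈ C i.
  by apply: (@in_vsep (subs g s)) => z [].
exists S; split=> [g gl|a al acf x xcof xs].
  split=> [y /SP[]//|]; apply/vcard_le => //.
  apply: card_le_trans (@vbigcup_le _ lsl (vsucc g) C _ _).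
  - by apply: elts_sub => y /SP[_ [i ig yi]]; apply/in_vbigcup; exists i.
  - by apply: succ_le => //; apply: mem_card_succ.
  - move=> i ig; have il : i ∈ l⁺ by apply: ord_trans ig => //; apply: lsucc_succ.
    by apply: approach_closure_le => // j; apply: idl'.
rewrite -tE in acf.
have oa := ord_mem os al; have [_ a0 alim] := cf_limit treg oa acf.
have [xa xc] := xcof.
have xbig : x ⊆ vbigcup a id.
  move=> b /xa ba; apply/in_vbigcup; exists (vsucc b); first exact: alim.
  exact: vsucc_refl.
have [|R [c [Rt cR cQ]]] := approach_closure_color idl _ al acf xbig; first by [].
have Rs : elts R #<= elts s by apply/(lt_card_succ _ sca); rewrite -tE.
have [h [hin hinj]] := card_leE Rs.
pose y n := vset (fun b => b ∈ x /\ h (c b) = n).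
have yP n b : b ∈ y n <-> b ∈ x /\ h (c b) = n by apply: (@in_vsep x) => z [].
exists y; split.
  apply: vext => b; rewrite in_vbigcup; split=> [bx|[n _ /yP[]//]].
  by exists (h (c b)); [apply/hin/cR|apply/yP].
move=> n ns J /in_subs[Jy Js].
have Jx : J ⊆ x by move=> b /Jy/yP[].
have Jt : vcard J ∈ t by rewrite Js.
have [r rR Jr] : exists2 r, r ∈ R & forall b, b ∈ J -> c b = r.
  have [[b0 b0J]|J0] := pselect (exists b, b ∈ J).
    exists (c b0); first by apply/cR/Jx.
    move=> b bJ; apply: hinj; [by apply/cR/Jx|by apply/cR/Jx|].
    by have /yP[_ ->] := Jy _ bJ; have /yP[_ ->] := Jy _ b0J.
  (* For an empty [J] any colour occurring on [x] serves. *)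
  have [b0 b0x] : exists b, b ∈ x.
    have [b ba] : exists b, b ∈ a.
      apply: contrapT => n0; apply: a0; apply: vsub_antisym; last exact: vempty_sub.
      by move=> b ba; case: n0; exists b.
    by have [b' b'x _] := xc b ba; exists b'.
  by exists (c b0); [apply: cR|move=> b bJ; case: J0; exists b].
have [g ga Jg] := cQ r J rR Jx Jt Jr.
have [||b ba Jb] := @bounded_cf a J oa; [by rewrite acf|by move=> w /Jx/xa|].
have [m ma [gm bm]] := max_in_ord oa ga ba.
apply/in_vbigcup; exists m => //; apply/SP; split; first by apply/in_subs; split=> // w /Jb/bm.
exists g => //; apply/in_vsucc; exact: ord_le (ord_mem oa ga) (ord_mem oa ma) gm.
Qed.

End Colorings.

(** * Chains of weakly closed Skolem hulls *)

Section Chains.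

Variables (l t : V) (lsl : is_strong_limit l) (treg : is_regular t) (tl : t ∈ l).

Let lc : is_card l. Proof. by case: lsl => -[]. Qed.
Let ol : is_ord l. Proof. exact: ord_card lc. Qed.
Let sc : is_card l⁺. Proof. by case: (card_succP lc). Qed.
Let os : is_ord l⁺. Proof. exact: ord_card sc. Qed.
Let tc : is_card t. Proof. by case: treg => -[]. Qed.
Let tinf : infinite_set (elts t). Proof. by case: treg => -[]. Qed.

Variables (T : V) (Tcard : is_card T) (lT : l⁺ ∈ T).
Let H := Hset T.

Lemma Hset_le x : (forall y, y ∈ x -> y ∈ H) -> elts x #<= elts l -> x ∈ H.
Proof.
move=> xH xl; apply/in_Hset; split=> //.
by apply: ord_trans (ord_card Tcard) lT _; apply/lt_card_succ.
Qed.

Lemma Hset_mem x y : x ∈ H -> y ∈ x -> y ∈ H.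
Proof. by move=> /in_Hset[_]; apply. Qed.

Lemma Hset_empty : vempty ∈ H.
Proof.
apply: Hset_le => [y /in_vempty//|]; apply: card_le_trans (@card_ge0 V V (elts l)).
by apply: subset_card_le => y /in_vempty.
Qed.

Lemma witness_H p n s : witness H p n s ∈ H.
Proof. by rewrite /witness; case: xgetP => [x _ []//|_]; apply: Hset_empty. Qed.

Definition skolem_step (Y : V) : set V :=
  [set z | exists p n s, (forall x, x \in s -> x ∈ Y) /\ z = witness H p n s].

Lemma skolem_step_le Y : elts Y #<= elts l -> skolem_step Y #<= elts l.
Proof.
move=> Yl.
have fl : [set: formula] #<= elts l.
  apply: card_le_trans (nat_le lsl).
  apply: (@card_leI _ _ _ _ (fun p => pickle (fcode p))) => // p q _ _.
  by move=> /(pcan_inj pickleK)/fcode_inj.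
have seql p n : witness H p n @` [set s : seq V | forall x, x \in s -> elts Y x] #<= elts l.
  exact: card_le_trans (card_image_le _ _) (card_le_lseq lsl Yl).
apply: card_le_trans (card_le_lbigcup lsl fl
  (fun p _ => card_le_lbigcupT lsl (fun n : nat => seql p n))).
apply: subset_card_le => z [p [n [s [sY ->]]]].
by exists p => //; exists n => //; exists s.
Qed.

Lemma small_sub_H Y y : (forall x, x ∈ Y -> x ∈ H) -> y ⊆ Y -> vcard y ∈ t -> y ∈ H.
Proof.
move=> YH yY yt; apply: Hset_le => [x /yY/YH//|]; apply: lt_le => //.
exact: ord_trans tl yt.
Qed.

Definition hull_step (Y : V) : V :=
  vset (fun z => [\/ z ∈ Y, skolem_step Y z | z ∈ small_closure t lsl Y]).

Lemma hull_stepP Y : elts Y #<= elts l -> elts (hull_step Y) #<= elts l /\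
  forall z, z ∈ hull_step Y <-> [\/ z ∈ Y, skolem_step Y z | z ∈ small_closure t lsl Y].
Proof.
move=> Yl.
have Sl : [set z | [\/ z ∈ Y, skolem_step Y z | z ∈ small_closure t lsl Y]] #<= elts l.
  apply: card_le_trans (card_le_lsetU lsl (card_le_lsetU lsl Yl (skolem_step_le Yl))
    (small_closure_le t lsl Yl)).
  by apply: subset_card_le => z [?|?|?]; [left; left|left; right|right].
have SP z := in_vset_card Sl z; split=> //.
by apply: card_le_trans Sl; apply: subset_card_le => z /SP.
Qed.

(** Close off in [nat] many steps. If some [K n] contains [t] members of [I], a homogeneous set
    among them has its small subsets added at step [n.+1]. Otherwise [t] is countable, and [I]
    itself works: its subsets of size below [t] are finite, so each lies in one [K n]. *)
Lemma hull_ex Y : (forall y, y ∈ Y -> y ∈ H) -> elts Y #<= elts l ->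
  exists M, [/\ Y ⊆ M, forall y, y ∈ M -> y ∈ H, elts M #<= elts l,
    skolem_closed H M & weakly_closed t M].
Proof.
move=> YH Yl; pose K n := iter n hull_step Y.
have Kl n : elts (K n) #<= elts l.
  by elim: n => // n IH; case: (hull_stepP IH).
have KP n z : z ∈ K n.+1 <-> [\/ z ∈ K n, skolem_step (K n) z | z ∈ small_closure t lsl (K n)].
  by case: (hull_stepP (Kl n)).
have KS n : K n ⊆ K n.+1 by move=> z zK; apply/KP; constructor 1.
have Kmono m n : (m <= n)%N -> K m ⊆ K n.
  by elim: n => [|n IH]; [rewrite leqn0 => /eqP->|
    rewrite leq_eqVlt => /orP[/eqP->//|/IH mn] z /mn/KS].
have Kdir m n : exists k, K m ⊆ K k /\ K n ⊆ K k.
  by exists (maxn m n); split; apply: Kmono; rewrite ?leq_maxl ?leq_maxr.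
have KH n y : y ∈ K n -> y ∈ H.
  elim: n y => [|n IH] y; first exact: YH.
  move=> /KP[/IH//|[p [m [s [_ ->]]]]|/(small_closure_sub (Kl n))[yK yt]].
    exact: witness_H.
  exact: small_sub_H IH yK yt.
have MP z : z ∈ vset (fun z => exists n, z ∈ K n) <-> exists n, z ∈ K n.
  exact: in_vset_Union.
exists (vset (fun z => exists n, z ∈ K n)); split.
- by move=> y yY; apply/MP; exists 0%N.
- by move=> y /MP[n]; apply: KH.
- apply: card_le_trans (card_le_lbigcupT lsl Kl).
  by apply: subset_card_le => z /MP[n]; exists n.
- move=> p n s sM; apply/MP.
  have [x /sM/MP//|i si] := @seq_directed nat K s 0%N Kdir.
  by exists i.+1; apply/KP; constructor 2; exists p, n, s.
- move=> I /in_subs[IM It].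
  have Iinf : elts I #= elts t by apply/vcard_eq.
  have [[n tn]|nn] := pselect (exists n, elts t #<= elts (vcap I (K n))).
    have JI : vcard (vcap I (K n)) = t.
      apply/vcard_eq => //; rewrite card_eq_le tn andbT -(card_le_eqr Iinf).
      by apply: elts_sub => z /in_vcap[].
    have [|J /in_subs[Jn Jt] JQ] := colorable_homogeneous treg
        (@small_closure_color _ _ lsl treg (K n) (vcap I (K n)) (Kl n) _) JI.
      by move=> z /in_vcap[].
    exists J; first by apply/in_subs; split=> // z /Jn/in_vcap[].
    by move=> y /JQ yC; apply/MP; exists n.+1; apply/KP; constructor 3.
  have [tnat|tnat] := pselect (elts t #<= [set: nat]).
    exists I; first by apply/in_subs; split=> // z.
    move=> y /in_subs_lt[yI yt].
    have yfin : finite_set (elts y).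
      apply: contrapT => /infiniteP ny; have /vcard_lt := yt; apply => //.
      exact: card_le_trans tnat ny.
    have [x /yI/IM/MP//|n yn] := @finite_directed nat K y 0%N Kdir yfin.
    by apply/MP; exists n.+1; apply/KP; constructor 3; apply: small_closure_finite.
  (* [t] is uncountable and regular, so some [K n] does contain [t] members of [I]. *)
  exfalso.
  have /card_leE[e [ein einj]] := (infiniteP (elts t)).1 tinf.
  (* A copy of [nat] inside [t] indexes the union, since [regular_bigcup] takes its index set in
     [V]. *)
  have wP i : i ∈ vset (fun i => exists n : nat, i = e n) <-> exists n, i = e n.
    by apply: (@in_vsep t) => z [n ->]; apply: ein.
  have wt : vcard (vset (fun i => exists n : nat, i = e n)) ∈ t.
    apply/vcard_lt => // tw; apply: tnat; apply: card_le_trans tw _.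
    apply: card_le_trans (card_image_le e [set: nat]); apply: subset_card_le.
    by move=> i /wP[n ->]; exists n.
  have /choice[d dP] : forall i, exists n, (exists n, i = e n) -> i = e n.
    move=> i; have [[n ie]|ni] := pselect (exists n, i = e n); last by exists 0%N.
    by exists n.
  apply: (@vmem_irrefl t); rewrite -{1}It.
  have -> : I = vbigcup (vset (fun i => exists n : nat, i = e n)) (fun i => vcap I (K (d i))).
    apply: vext => x; rewrite in_vbigcup; split=> [xI|[i _ /in_vcap[]//]].
    have /MP[n xK] := IM _ xI; exists (e n); first by apply/wP; exists n.
    apply/in_vcap; split=> //.
    by have /einj <- : e n = e (d (e n)) by apply: dP; exists n.
  apply: regular_bigcup => // i _; apply/vcard_lt => // tK.
  by apply: nn; exists (d i).
Qed.

Lemma vgraph_H c M : (forall i, i ∈ c -> i ∈ H /\ M i ∈ H) -> elts c #<= elts l ->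
  vgraph c M ∈ H.
Proof.
move=> cH cl.
have pairH x y : x ∈ H -> y ∈ H -> vpair x y ∈ H.
  move=> xH yH; apply: Hset_le => [z /in_vpair[]-> //|].
  apply: card_le_trans (card_le_lsetU lsl (card_le_lset1 lsl x) (card_le_lset1 lsl y)).
  by apply: subset_card_le => z /in_vpair.
apply: Hset_le => [z /in_vimage[i /cH[iH MH] ->]|].
  by apply: (pairH _ _ (pairH _ _ iH iH) (pairH _ _ iH MH)).
apply: card_le_trans cl; apply: card_le_trans (card_image_le (fun i => vopair i (M i)) _).
by apply: subset_card_le => z /in_vimage[i ic ->]; exists i.
Qed.

Variables (P : V -> V) (Pl : forall g, g ∈ l⁺ -> elts (P g) #<= elts l).
Hypothesis (Pd : forall d, d ∈ l⁺ -> cf d = t -> exists2 z, thin_cofinal t z d &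
      forall b, b ∈ d -> exists2 g, g ∈ d & vcap z b ∈ P g).

(** The stage [M c] is the union of [base] and the hulls of [S b M] for [b] below [c], where [S b M]
    adds to [M b] its approach closure, the history up to [b] and the element [a b]. Continuity is
    then built in, and weak closure at a limit [c] follows by comparing [cf c] with [t]. *)
Lemma chain_ex (B : V) (a : V -> V) : B ∈ H -> (forall b, b ∈ l⁺ -> a b ∈ H) ->
  exists M : V -> V,
    [/\ in_chain l⁺ M, continuous l⁺ M,
        forall i, i ∈ l⁺ ->
          [/\ elem_submodel (M i) H, weakly_closed t (M i) & vcard (M i) ∈ l⁺],
        B ∈ M vempty &
        forall b, b ∈ l⁺ -> a b ∈ vbigcup l⁺ M].
Proof.
move=> BH aH.
pose good Y := (forall y, y ∈ Y -> y ∈ H) /\ elts Y #<= elts l.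
have /choice[h hP] : forall Y, exists M, good Y ->
    [/\ Y ⊆ M, good M, skolem_closed H M & weakly_closed t M].
  move=> Y; have [[YH Yl]|n] := pselect (good Y); last by exists Y.
  by have [M [YM MH Ml Msk Mw]] := hull_ex YH Yl; exists M.
pose S b M := vset (fun z => [\/ z ∈ M b, z ∈ approach_closure t lsl P M b,
  z = vgraph (vsucc b) M | z = a b]).
have Sext b M M' : (forall i, i ∈ vsucc b -> M i = M' i) -> S b M = S b M'.
  move=> MM'; rewrite /S (approach_closure_ext t lsl P MM') (MM' _ (vsucc_refl b)).
  have -> // : vgraph (vsucc b) M = vgraph (vsucc b) M'.
  apply: vext => z; rewrite !in_vimage; split=> -[i ib ->]; exists i => //.
    by rewrite MM'.
  by rewrite MM'.
pose base := h (vpair B B).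
(* The recursion at [c] may only use values at members of [c], which for an
   ordinal [c] is no restriction. *)
pose cut (M : V -> V) c i := if `[< i ∈ c >] then M i else vempty.
have [M ME0] : exists M : V -> V, forall c, M c =
    vunion (vpair base (vbigcup c (fun b => h (S b (cut M c))))).
  apply: vrec => c M M' MM'.
  suff -> : cut M c = cut M' c by [].
  by apply/funext => i; rewrite /cut; case: asboolP => // /MM'.
have MP c z : is_ord c -> z ∈ M c <-> z ∈ base \/ exists2 b, b ∈ c & z ∈ h (S b M).
  move=> oc; rewrite ME0 in_vunion.
  have SE b : b ∈ c -> S b (cut M c) = S b M.
    move=> bc; apply: Sext => i ib; rewrite /cut asboolT //.
    by move: ib => /in_vsucc[ib|->//]; apply: ord_trans ib.
  split.
    move=> [y /in_vpair[->|->] zy]; first by left.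
    by right; move: zy => /in_vbigcup[b bc]; rewrite SE // => zb; exists b.
  move=> [zb|[b bc zb]].
    by exists base => //; apply/in_vpair; left.
  exists (vbigcup c (fun b => h (S b (cut M c)))); first by apply/in_vpair; right.
  by apply/in_vbigcup; exists b; rewrite ?SE.
have baseP : [/\ vpair B B ⊆ base, good base, skolem_closed H base & weakly_closed t base].
  apply: hP; split; first by move=> y /in_vpair[]->.
  apply: card_le_trans (card_le_lset1 lsl B).
  by apply: subset_card_le => y /in_vpair[]->.
have goodS b : b ∈ l⁺ -> (forall i, i ∈ vsucc b -> good (M i)) -> good (S b M) /\
    forall z, z ∈ S b M <-> [\/ z ∈ M b, z ∈ approach_closure t lsl P M b,
      z = vgraph (vsucc b) M | z = a b].
  move=> bl Mgood; have Ml i : i ∈ vsucc b -> elts (M i) #<= elts l by move=> /Mgood[].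
  have sbl : elts (vsucc b) #<= elts l by apply: succ_le => //; apply: mem_card_succ.
  have Sl : [set z | [\/ z ∈ M b, z ∈ approach_closure t lsl P M b,
      z = vgraph (vsucc b) M | z = a b]] #<= elts l.
    apply: card_le_trans (card_le_lsetU lsl (card_le_lsetU lsl (Ml b (vsucc_refl b))
      (approach_closure_le lsl tl Pl bl Ml)) (card_le_lsetU lsl
      (card_le_lset1 lsl (vgraph (vsucc b) M)) (card_le_lset1 lsl (a b)))).
    by apply: subset_card_le => z [?|?|?|?]; [left; left|left; right|right; left|right; right].
  have SP z := in_vset_card Sl z; split=> //; split; last first.
    by apply: card_le_trans Sl; apply: subset_card_le => z /SP.
  move=> z /SP[|||->].
  - by move=> zM; case: (Mgood b (vsucc_refl b)) => MH _; apply: MH.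
  - move=> /(approach_closure_sub tl Pl bl Ml)[zM zt]; apply: small_sub_H zM zt.
    by move=> x /in_vbigcup[i /Mgood[MH _] /MH].
  - move=> ->; apply: vgraph_H => // i ib; split.
      apply: ord_Hset => //; apply: ord_trans (ord_card Tcard) lT _.
      by apply: ord_trans ib => //; apply: lsucc_succ.
    by have [MH Ml'] := Mgood i ib; apply: Hset_le.
  - exact: aH.
have goodM c : c ∈ l⁺ -> good (M c).
  elim/vmem_ind: c => c IH cl.
  have oc := ord_mem os cl.
  have hgood b : b ∈ c -> good (h (S b M)).
    move=> bc; have bl : b ∈ l⁺ by apply: ord_trans bc.
    have [Sgood _] : good (S b M) /\ forall z, z ∈ S b M <-> [\/ z ∈ M b,
      z ∈ approach_closure t lsl P M b, z = vgraph (vsucc b) M | z = a b].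
      apply: goodS => // i ib; have ic : i ∈ c.
        by move: ib => /in_vsucc[ib|->//]; apply: ord_trans ib.
      by apply: IH => //; apply: ord_trans ic.
    by have [] := hP _ Sgood.
  have [_ [baseH basel] _ _] := baseP.
  split=> [y /(MP _ _ oc)[/baseH//|[b /hgood[hH _] /hH//]]|].
  apply: card_le_trans (card_le_lsetU lsl basel
    (@vbigcup_le _ lsl c (fun b => h (S b M)) _ _)).
  - apply: subset_card_le => y /(MP _ _ oc)[?|[b bc yb]]; [left|right] => //.
    by apply/in_vbigcup; exists b.
  - exact: mem_card_succ.
  - by move=> b /hgood[].
have Ml i : i ∈ l⁺ -> elts (M i) #<= elts l by move=> /goodM[].
have goodM' b i : b ∈ l⁺ -> i ∈ vsucc b -> good (M i).
  by move=> bl ib; apply: goodM; apply: ord_trans ib => //; apply: lsucc_succ.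
have SP b z : b ∈ l⁺ -> z ∈ S b M <-> [\/ z ∈ M b, z ∈ approach_closure t lsl P M b,
      z = vgraph (vsucc b) M | z = a b].
  by move=> bl; have [_ ->] := goodS b bl (fun i => @goodM' b i bl).
have hSP b : b ∈ l⁺ -> [/\ S b M ⊆ h (S b M), good (h (S b M)),
    skolem_closed H (h (S b M)) & weakly_closed t (h (S b M))].
  by move=> bl; apply: hP; have [] := goodS b bl (fun i => @goodM' b i bl).
have Mmono i j : i ⊆ j -> j ∈ l⁺ -> is_ord i -> M i ⊆ M j.
  move=> ij jl oi z /(MP _ _ oi) H'; apply/(MP _ _ (ord_mem os jl)).
  by case: H' => [|[b bi zb]]; [left|right; exists b => //; apply: ij].
(* The earlier hulls lie in [M b], which the last hull contains. *)
have Msucc b : b ∈ l⁺ -> M (vsucc b) = h (S b M).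
  move=> bl; have [Sh _ _ _] := hSP b bl; have ob := ord_mem os bl.
  apply: vext => z; rewrite (MP _ _ (ord_succ ob)); split.
    have Mb : M b ⊆ h (S b M) by move=> y yM; apply: Sh; apply/SP => //; constructor 1.
    move=> [zb|[b' /in_vsucc[b'b|->//] zb]]; apply: Mb; apply/(MP _ _ ob); first by left.
    by right; exists b'.
  by move=> zh; right; exists b => //; apply: vsucc_refl.
have Mlim d : d ∈ l⁺ -> is_limit d -> M d = vbigcup d M.
  move=> dl [od d0 dlim]; apply: vext => z; rewrite in_vbigcup; split.
    move=> /(MP _ _ od)[zb|[b bd zb]].
      have [e ed] : exists e, e ∈ d.
        apply: contrapT => n; apply: d0; apply: vsub_antisym; last exact: vempty_sub.
        by move=> e ed; case: n; exists e.
      by exists e => //; apply/MP; [apply: ord_mem ed|left].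
    by exists (vsucc b); [apply: dlim|rewrite Msucc //; apply: ord_trans bd].
  move=> [i iD]; apply: Mmono => //; last exact: ord_mem iD.
  exact: ord_subset.
have Mskolem c : c ∈ l⁺ -> skolem_closed H (M c).
  move=> cl p n s sM; have oc := ord_mem os cl.
  (* [M c] as a directed union indexed by all of [V], with [base] at the indices outside [c], such
     as [c] itself. *)
  pose F i := if `[< i ∈ c >] then h (S i M) else base.
  have hmono i j : i ∈ j -> j ∈ l⁺ -> h (S i M) ⊆ h (S j M).
    move=> ij jl; rewrite -!Msucc //; last by apply: ord_trans ij.
    have oj := ord_mem os jl; have oi := ord_mem oj ij.
    apply: Mmono; [|exact: lsucc_succ|exact: ord_succ].
    by move=> z /(ord_succ_le oj ij) zj; apply: sub_vsucc.
  have bmono j : j ∈ l⁺ -> base ⊆ h (S j M).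
    move=> jl z zb; rewrite -Msucc //; apply/MP; last by left.
    by apply: ord_succ; apply: ord_mem jl.
  have cl' i : i ∈ c -> i ∈ l⁺ by apply: ord_trans.
  have Fdir i j : exists k, F i ⊆ F k /\ F j ⊆ F k.
    have [ic|nic] := pselect (i ∈ c); have [jc|njc] := pselect (j ∈ c).
    - have [ij|->|ji] := ord_tri (ord_mem oc ic) (ord_mem oc jc).
      + by exists j; split=> //; rewrite /F !asboolT //; apply: hmono => //; apply: cl'.
      + by exists j.
      + by exists i; split=> //; rewrite /F !asboolT //; apply: hmono => //; apply: cl'.
    - by exists i; split=> //; rewrite /F asboolF // asboolT //; apply: bmono; apply: cl'.
    - by exists j; split=> //; rewrite /F asboolF // asboolT //; apply: bmono; apply: cl'.
    - by exists i; rewrite /F !asboolF.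
  have [x /sM/(MP _ _ oc)[xb|[b bc xb]]|i si] := @seq_directed V F s c Fdir.
  - by exists c; rewrite /F asboolF //; apply: vmem_irrefl.
  - by exists b; rewrite /F asboolT.
  apply/(MP _ _ oc); move: si; rewrite /F; case: asboolP => ic si.
    by right; exists i => //; have [_ _ Hsk _] := hSP i (cl' i ic); apply: Hsk.
  by left; have [_ _ Hsk _] := baseP; apply: Hsk.
have Mweak c : c ∈ l⁺ -> weakly_closed t (M c).
  elim/vmem_ind: c => c IH cl; have oc := ord_mem os cl.
  have [c0|c0] := pselect (c = vempty).
    have -> : M c = base; last by case: baseP.
    apply: vext => z; rewrite (MP _ _ oc) c0; split; last by left.
    by move=> [//|[b /in_vempty]].
  have [[b bc cE]|nsucc] := pselect (exists2 b, b ∈ c & c = vsucc b).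
    have bl : b ∈ l⁺ by apply: ord_trans bc.
    by rewrite cE Msucc //; have [] := hSP b bl.
  have clim : is_limit c.
    split=> // b bc; have [//|E] := ord_le (ord_succ (ord_mem oc bc)) oc (ord_succ_le oc bc).
    by case: nsucc; exists b.
  have IHcap i I : i ∈ c -> I ⊆ M c -> vcard I = t -> elts t #<= elts (vcap I (M i)) ->
      exists2 J, J ∈ subs I t & subs_lt J t ⊆ M c.
    move=> ic IM It tI.
    have [|J /in_subs[JI Jt] JM] := IH i ic (ord_trans os cl ic) (vcap I (M i)).
      apply/in_subs; split=> [z /in_vcap[]//|]; apply/vcard_eq => //.
      rewrite card_eq_le tI andbT -(card_le_eqr ((vcard_eq I tc).1 It)).
      by apply: elts_sub => z /in_vcap[].
    exists J; first by apply/in_subs; split=> // z /JI/in_vcap[].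
    move=> y /JM; apply: Mmono => //; last exact: ord_mem ic.
    exact: ord_subset.
  move=> I /in_subs[IM It].
  have IM' := IM; rewrite Mlim // in IM'.
  have [cc [e [ec ecof] eE] _] := cfP oc.
  have [ct|ct|tcf] := ord_tri (ord_card cc) (ord_card tc).
  (* Case [cf c < t]: [I] is a union of fewer than [t] parts, so some earlier stage has [t] members
     of it. *)
  - have [i ie tI] : exists2 i, i ∈ e & elts t #<= elts (vcap I (M i)).
      apply: contrapT => ni; apply: (@vmem_irrefl t); rewrite -{1}It.
      have -> : I = vbigcup e (fun i => vcap I (M i)).
        apply: vext => x; rewrite in_vbigcup; split=> [xI|[i _ /in_vcap[]//]].
        have /in_vbigcup[i ic xi] := IM' _ xI; have [j je ij] := ecof i ic.
        exists j => //; apply/in_vcap; split=> //; apply: Mmono xi => //.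
          by apply: ord_trans cl (ec _ je).
        exact: ord_mem ic.
      apply: regular_bigcup => //; first by rewrite (vcard_eq _ cc).2.
      by move=> i ie; apply/vcard_lt => // tI; apply: ni; exists i.
    by apply: IHcap tI => //; apply: ec.
  (* Case [cf c = t], where approachability enters: the approach closure at [g] below [c] goes into
     the hull of [S g M], a part of [M c]. *)
  - have Mm i j : i ⊆ j -> i ∈ l⁺ -> j ∈ l⁺ -> M i ⊆ M j.
      by move=> ij il jl; apply: Mmono => //; apply: ord_mem il.
    have [J JI JQ] := colorable_homogeneous treg
        (approach_closure_color lsl treg tl Pl Pd Ml Mm cl ct IM') It.
    exists J => // y /JQ[g gc yg].
    have gl : g ∈ l⁺ by apply: ord_trans gc.
    apply/(MP _ _ oc); right; exists g => //; have [Sh _ _ _] := hSP g gl.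
    by apply: Sh; apply/SP => //; constructor 2.
  (* Case [t < cf c]: all of [I] lies in one earlier stage. *)
  - have /choice[g gP] : forall x, exists i, x ∈ I -> i ∈ c /\ x ∈ M i.
      move=> x; have [/IM'/in_vbigcup[i]|nx] := pselect (x ∈ I); last by exists x.
      by exists i.
    have [||b bc bP] := @bounded_fun c I g oc; first by rewrite It.
      by move=> i /gP[].
    apply: (IHcap b) => //; have /card_eqPle[_ tI] := (vcard_eq I tc).1 It.
    apply: card_le_trans tI _; apply: elts_sub => x xI; apply/in_vcap; split=> //.
    have [gc xg] := gP x xI; apply: Mmono xg; [|exact: ord_trans cl bc|exact: ord_mem gc].
    by apply: ord_subset (bP x xI); apply: ord_mem bc.
exists M; split.
- move=> i j ij jl; split.
    apply: Mmono => //; first by apply: ord_subset => //; apply: ord_mem jl.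
    by apply: ord_mem ij; apply: ord_mem jl.
  move=> _; rewrite Msucc //; have [Sh _ _ _] := hSP j jl; apply: Sh.
  by apply/SP => //; constructor 3.
- exact: Mlim.
- move=> i il; split.
  + by apply: skolem_elem; [case: (goodM i il)|apply: Mskolem].
  + exact: Mweak.
  + by apply/lt_card_succ => //; apply: Ml.
- apply/MP; first exact: ord_empty.
  by left; have [Bb _ _ _] := baseP; apply: Bb; apply/in_vpair; left.
- move=> b bl; apply/in_vbigcup; exists (vsucc b); first exact: lsucc_succ.
  rewrite Msucc //; have [Sh _ _ _] := hSP b bl; apply: Sh.
  by apply/SP => //; constructor 4.
Qed.

End Chains.

(** * The cycle of implications *)

Lemma approachable_CECA l t : is_strong_limit l -> is_regular t -> t ∈ l ->
  approachable l t -> CECA t l⁺.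
Proof.
move=> lsl treg tl [P [Pl Pd]] T Tc lT A B AH BH Al Bl.
have lc : is_card l by case: lsl => -[].
have [sc _ _] := card_succP lc.
have [a [ain _ asurj]] : exists a : V -> V, [/\ forall x, x ∈ l⁺ -> a x ∈ A,
    forall x y, x ∈ l⁺ -> y ∈ l⁺ -> a x = a y -> x = y &
    forall y, y ∈ A -> exists2 x, x ∈ l⁺ & a x = y].
  by apply: card_eqE; rewrite card_eq_sym; apply/vcard_eq.
have aH b : b ∈ l⁺ -> a b ∈ Hset T by move=> /ain; apply: Hset_mem.
have [M [M1 M2 M3 M4 M5]] := chain_ex lsl treg tl Tc lT Pl Pd BH aH.
exists M; rewrite cf_lsucc //; split=> // y /asurj[b bl <-]; exact: M5.
Qed.

(** Cover [l⁺] by a chain with [Θ = (l⁺)⁺]. Its members have size at most [l]. As [l⁺] is regular,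
    some stage [i0] contains all of [l], and from there on the size is exactly [l]. *)
Lemma CECA_Pr l t : is_strong_limit l -> CECA t l⁺ -> Pr l t.
Proof.
move=> lsl ceca.
have lc : is_card l by case: lsl => -[].
have [sc ll _] := card_succP lc; have os := ord_card sc.
have [Tc lT _] := card_succP sc.
have AH : l⁺ ∈ Hset (l⁺)⁺ by apply: ord_Hset.
have El : elts vempty #<= elts l by apply: elts_sub; apply: vempty_sub.
have BH : vempty ∈ Hset (l⁺)⁺.
  apply/in_Hset; split=> [|y /in_vempty//].
  by apply: ord_trans (ord_card Tc) lT _; apply/lt_card_succ.
have [|M []] := ceca _ Tc lT _ _ AH BH (vcard_card sc); first exact/lt_card_succ.
rewrite cf_lsucc // => Mch Mcont MP _ MA.
have Mmono i j : i ⊆ j -> is_ord i -> j ∈ l⁺ -> M i ⊆ M j.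
  move=> ij oi jl; have [/Mch/(_ jl)[]//|-> //] := ord_le oi (ord_mem os jl) ij.
have Ml i : i ∈ l⁺ -> elts (M i) #<= elts l by move=> /MP[_ _] /lt_card_succ; apply.
have /choice[h hP] : forall b, exists i, b ∈ l⁺ -> i ∈ l⁺ /\ b ∈ M i.
  move=> b; have [/MA/in_vbigcup[i]|nb] := pselect (b ∈ l⁺); last by exists b.
  by exists i.
have lsub b : b ∈ l -> b ∈ l⁺ by apply: ord_trans.
have [||i0 i0l i0P] := @bounded_fun l⁺ l h os.
- by rewrite cf_lsucc // vcard_card.
- by move=> b /lsub/hP[].
have oi0 := ord_mem os i0l.
(* The maximum of [i] and [i0]: the new chain is constant up to [i0], which keeps it continuous, and
   agrees with [M] afterwards. *)
pose mx i := if `[< i0 ⊆ i >] then i else i0.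
have mxP i : i ∈ l⁺ -> [/\ mx i ∈ l⁺, i0 ⊆ mx i & i ⊆ mx i].
  move=> il; rewrite /mx; case: asboolP => // n; split=> //.
  by apply: ord_subset => //; apply: ord_leNlt n => //; apply: ord_mem il.
have mxle i j : i ∈ j -> j ∈ l⁺ -> mx i ⊆ mx j.
  move=> ij jl; have oj := ord_mem os jl; have [ml i0m jm] := mxP j jl.
  rewrite {1}/mx; case: asboolP => // _; have := ord_subset oj ij.
  by move=> ij' z /ij'/jm.
exists (fun i => M (mx i)); split.
- move=> i j ij jl; have [ml _ _] := mxP j jl.
  apply: Mmono => //; first exact: mxle.
  by apply: (ord_mem os); have [] := mxP i (ord_trans os jl ij).
- move=> d dl dlim; have [od d0 dsucc] := dlim.
  apply: vext => z; rewrite in_vbigcup; split; last first.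
    move=> [i iD]; have [ml _ _] := mxP d dl; apply: Mmono => //; first exact: mxle.
    by apply: (ord_mem os); have [] := mxP i (ord_trans os dl iD).
  rewrite {1}/mx; case: asboolP => [i0d|ni0d].
    rewrite Mcont // => /in_vbigcup[i iD zi]; exists i => //.
    have [ml _ im] := mxP i (ord_trans os dl iD); apply: Mmono zi => //.
    exact: ord_mem iD.
  have [e ed] : exists e, e ∈ d.
    apply: contrapT => n; apply: d0; apply: vsub_antisym; last exact: vempty_sub.
    by move=> e ed; case: n; exists e.
  move=> zi; exists e => //; have [ml im _] := mxP e (ord_trans os dl ed).
  exact: Mmono zi.
- move=> i il; have [ml im _] := mxP i il; have [_ Mw _] := MP _ ml; split=> //.
  apply/vcard_eq => //; rewrite card_eq_le Ml //=; apply: elts_sub => b bl.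
  have [hl bM] := hP b (lsub b bl); apply: Mmono bM => //; last exact: ord_mem hl.
  by move=> z /(ord_trans oi0 (i0P b bl)) /im.
- move=> b bl; have [hl bM] := hP b bl; apply/in_vbigcup; exists (h b) => //.
  by have [ml _ hm] := mxP _ hl; apply: Mmono bM => //; apply: ord_mem hl.
Qed.

Lemma Pr_Pr' l t : Pr l t -> Pr' l t.
Proof.
move=> [N [N1 N2 N3 N4]]; exists N; split=> // i il; have [Nl Nw] := N3 i il.
by split=> // I IN _; apply: Nw.
Qed.

Lemma approachable_Sp l t s : is_strong_limit l -> is_regular t -> t ∈ l ->
  is_card s -> t = s⁺ -> approachable l t -> Sp s l.
Proof. by move=> lsl tr tl sc tE [P [Pl Pd]]; apply: sequence_Sp Pd _ sc tE. Qed.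

Theorem theorem1 (t l : V)
    (ht : is_inf_card t) (hl : is_inf_card l) (htl : t ∈ l)
    (treg : is_regular t) (lsing : is_singular l) (lsl : is_strong_limit l) :
  [<-> Scof (l⁺) t ∈ approach_ideal (l⁺);
       Pr l t;
       Pr' l t;
       CECA t (l⁺)] /\
  (forall s : V, is_card s -> t = s⁺ ->
   [<-> Scof (l⁺) t ∈ approach_ideal (l⁺);
        Pr l t;
        Pr' l t;
        CECA t (l⁺);
        Sp s l]).
Proof.
have aA := ideal_approachable lsl treg.
have Aa := approachable_ideal lsl treg htl.
have AC := approachable_CECA lsl treg htl.
have CP := CECA_Pr (t := t) lsl.
have PA := Pr'_approachable lsl treg (t := t).
split=> [|s sc tE].
  tfae.
  - by move=> /aA/AC/CP.
  - exact: Pr_Pr'.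
  - by move=> /PA/AC.
  - by move=> /CP/Pr_Pr'/PA/Aa.
(* The same cycle, with [Sp] inserted between [CECA] and the ideal. *)
tfae.
- by move=> /aA/AC/CP.
- exact: Pr_Pr'.
- by move=> /PA/AC.
- by move=> /CP/Pr_Pr'/PA; apply: approachable_Sp.
- by move=> /(Sp_approachable lsl treg sc tE)/Aa.
Qed.
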